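(* For every integer $k \leq 3$, GtMAJORITY-$k$SAT is in $\mathsf{P}$.
   Context: A $k$-CNF is a conjunction of clauses (disjunctions of literals) each with at most $k$ literals. GtMAJORITY-$k$SAT is the problem: given a $k$-CNF $F$ on $n$ variables, decide whether $F$ has strictly greater than $2^{n-1}$ satisfying assignments. *)

(* Defs.v *)
From HB Require Import structures.
From mathcomp Require Import all_boot all_order all_algebra.

Set Implicit Arguments.
Unset Strict Implicit.
Unset Printing Implicit Defensive.

(** * Deterministic multi-tape Turing machines and the class P *)

Inductive move := MoveL | Stay | MoveR.

(* A two-way infinite tape over the alphabet [S], the blank being [None]: in
   [Tape l r], the head scans the first cell of [r], and [l] lists the cells on
   its left, nearest first. All cells beyond [l] and [r] are blank. *)
Record tape (S : Type) := Tape { leftward : seq (option S); rightward : seq (option S) }.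

Definition tape_read (S : Type) (t : tape S) : option S := head None (rightward t).

Definition tape_write (S : Type) (s : option S) (t : tape S) : tape S :=
  Tape (leftward t) (s :: behead (rightward t)).

Definition tape_move (S : Type) (m : move) (t : tape S) : tape S :=
  let: Tape l r := t in
  match m with
  | MoveL => Tape (behead l) (head None l :: r)
  | Stay => t
  | MoveR => Tape (head None r :: l) (behead r)
  end.

(* A machine with [tm_work.+1] tapes. The tape alphabet is the disjoint union of
   the input alphabet [Sigma], of [tm_extra] and of the blank. A state [q] is
   accepting if [tm_verdict q = Some true], rejecting if it is [Some false]; the
   machine halts exactly in these states. *)
Record TM (Sigma : finType) := MkTM {
  tm_work : nat;
  tm_state : finType;
  tm_extra : finType;
  tm_start : tm_state;
  tm_verdict : tm_state -> option bool;
  tm_delta : tm_state -> {ffun 'I_tm_work.+1 -> option (Sigma + tm_extra)} ->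
    tm_state * {ffun 'I_tm_work.+1 -> option (Sigma + tm_extra) * move}
}.

Section Run.
Variables (Sigma : finType) (M : TM Sigma).

Definition tm_symbol : Type := (Sigma + tm_extra M)%type.

Record config := Config {
  cfg_state : tm_state M;
  cfg_tapes : 'I_(tm_work M).+1 -> tape tm_symbol
}.

Definition tm_init (w : seq Sigma) : config :=
  Config (tm_start M)
    (fun i => Tape [::] (if i == ord0 then [seq Some (inl a) | a <- w] else [::])).

Definition tm_step (c : config) : config :=
  if tm_verdict (cfg_state c) is Some _ then c else
  let: (q, act) := tm_delta (cfg_state c) [ffun i => tape_read (cfg_tapes c i)] in
  Config q (fun i => tape_move (act i).2 (tape_write (act i).1 (cfg_tapes c i))).

(* Halting configurations are fixed points of [tm_step], so this says that [M]
   halts on [w] after at most [t] steps with answer [b]. *)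
Definition answers_within (t : nat) (w : seq Sigma) (b : bool) : Prop :=
  tm_verdict (cfg_state (iter t tm_step (tm_init w))) = Some b.

Definition decides_in_time (T : nat -> nat) (L : seq Sigma -> Prop) : Prop :=
  forall w, exists2 b : bool, answers_within (T (size w)) w b & (b <-> L w).

End Run.

(* Every polynomial is bounded by [n ^ c + c] for some [c]. *)
Definition in_P (Sigma : finType) (L : seq Sigma -> Prop) : Prop :=
  exists (M : TM Sigma) (c : nat), decides_in_time M (fun n => n ^ c + c) L.

(** * CNF formulas *)

(* The literal [(true, x)] is x, the literal [(false, x)] is its negation. *)
Definition literal (n : nat) : Type := (bool * 'I_n)%type.
Definition clause (n : nat) : Type := seq (literal n).
Definition cnf (n : nat) : Type := seq (clause n).
Definition assignment (n : nat) : finType := {ffun 'I_n -> bool}.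

Definition lit_sat (n : nat) (a : assignment n) (l : literal n) : bool := a l.2 == l.1.
Definition clause_sat (n : nat) (a : assignment n) (C : clause n) : bool := has (lit_sat a) C.
Definition cnf_sat (n : nat) (a : assignment n) (F : cnf n) : bool := all (clause_sat a) F.

Definition is_kCNF (k : int) (n : nat) (F : cnf n) : bool :=
  all (fun C : clause n => (Posz (size C) <= k)%R) F.

Definition num_sat (n : nat) (F : cnf n) : nat := #|[set a : assignment n | cnf_sat a F]|.

(* #SAT(F) > 2^(n-1), where 2^(n-1) = 1/2 for n = 0. *)
Definition gt_majority (n : nat) (F : cnf n) : bool := 2 ^ n < 2 * num_sat F.

(** * Encoding of formulas as strings *)

Inductive cnf_symbol := Digit of bool | Sign of bool | EndClause.

Definition cnf_symbol_code (s : cnf_symbol) : option (bool + bool) :=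
  match s with
  | Digit b => Some (inl b)
  | Sign b => Some (inr b)
  | EndClause => None
  end.

Definition cnf_symbol_decode (s : option (bool + bool)) : cnf_symbol :=
  match s with
  | Some (inl b) => Digit b
  | Some (inr b) => Sign b
  | None => EndClause
  end.

Lemma cnf_symbol_codeK : cancel cnf_symbol_code cnf_symbol_decode.
Proof. by case. Qed.

HB.instance Definition _ := Finite.copy cnf_symbol (can_type cnf_symbol_codeK).

(* Binary expansion, least significant bit first, without superfluous zeros;
   that of 0 is the single digit 0. *)
Definition binary (m : nat) : seq bool :=
  mkseq (fun i => odd (m %/ 2 ^ i)) (trunc_log 2 m).+1.

Definition encode_nat (m : nat) : seq cnf_symbol := map Digit (binary m).

Definition encode_literal (n : nat) (l : literal n) : seq cnf_symbol :=
  Sign l.1 :: encode_nat l.2.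

Definition encode_clause (n : nat) (C : clause n) : seq cnf_symbol :=
  rcons (flatten (map (@encode_literal n) C)) EndClause.

Definition encode_cnf (n : nat) (F : cnf n) : seq cnf_symbol :=
  encode_nat n ++ flatten (map (@encode_clause n) F).

(* Strings that do not encode a k-CNF are not in the language. *)
Definition GtMajoritySAT (k : int) (w : seq cnf_symbol) : Prop :=
  exists (n : nat) (F : cnf n),
    [/\ w = encode_cnf F, is_kCNF k F & gt_majority F].

(** The encoding is injective, so membership of the string of a formula in the
    language depends on that formula only. *)

Lemma binaryK (m : nat) : \sum_(i < (trunc_log 2 m).+1) odd (m %/ 2 ^ i) * 2 ^ i = m.
Proof.
have E r : \sum_(i < r) odd (m %/ 2 ^ i) * 2 ^ i + m %/ 2 ^ r * 2 ^ r = m.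
  elim: r => [|r IH]; first by rewrite big_ord0 divn1 muln1.
  rewrite big_ord_recr /= -[RHS]IH -addnA; congr addn.
  rewrite expnSr divnMA divn2 mulnA [_ * 2 ^ r * 2]mulnAC -mulnDl muln2.
  by rewrite odd_double_half.
rewrite -[RHS](E (trunc_log 2 m).+1) [X in _ = _ + X * _]divn_small ?addn0 //.
by apply: trunc_log_ltn.
Qed.

Lemma binary_inj : injective binary.
Proof.
move=> m m' e; have /eqP := congr1 size e; rewrite !size_mkseq eqSS => /eqP es.
rewrite -[m]binaryK -[m']binaryK -es; apply: eq_bigr => i _.
have := congr1 (nth false ^~ i) e; rewrite !nth_mkseq // -?es //.
by move=> ->.
Qed.

Definition head_digit (s : seq cnf_symbol) : bool := if s is Digit _ :: _ then true else false.

Lemma encode_nat_cat_inj (m m' : nat) (s s' : seq cnf_symbol) :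
  ~~ head_digit s -> ~~ head_digit s' ->
  encode_nat m ++ s = encode_nat m' ++ s' -> m = m' /\ s = s'.
Proof.
rewrite /encode_nat => hs hs' e.
suff [/binary_inj -> ->] : binary m = binary m' /\ s = s' by [].
elim: (binary m) (binary m') e => [|b u IH] [|b' u'] //= e.
- by move: hs; rewrite e.
- by move: hs'; rewrite -e.
- by case: e => -> /IH [-> ->].
Qed.

Lemma encode_clause_cat_inj (n : nat) (C C' : clause n) (s s' : seq cnf_symbol) :
  encode_clause C ++ s = encode_clause C' ++ s' -> C = C' /\ s = s'.
Proof.
rewrite /encode_clause !cat_rcons.
elim: C C' => [|[b x] C IH] [|[b' x'] C'] //=; first by case.
have hd (D : clause n) t :
  ~~ head_digit (flatten (map (@encode_literal n) D) ++ EndClause :: t) by case: D.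
rewrite -!catA => e; have /= [<-] := congr1 (head EndClause) e.
have /= /encode_nat_cat_inj [] // := congr1 behead e.
by move=> /val_inj <- /IH [-> ->].
Qed.

Lemma encode_cnf_inj (n m : nat) (F : cnf n) (G : cnf m) :
  encode_cnf F = encode_cnf G -> existT cnf n F = existT cnf m G.
Proof.
have hd p (H : cnf p) : ~~ head_digit (flatten (map (@encode_clause p) H)).
  by case: H => [|[|[]]].
move=> /encode_nat_cat_inj [] // e; case: m / e G => G e; congr existT.
elim: F G e => [|C F IH] [|D G] //=.
- by case: D.
- by case: C.
- by move=> /encode_clause_cat_inj [-> /IH ->].
Qed.

Lemma GtMajoritySAT_encode (k : int) (n : nat) (F : cnf n) :
  GtMajoritySAT k (encode_cnf F) <-> is_kCNF k F && gt_majority F.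
Proof.
split=> [[m [G [/encode_cnf_inj e kG gG]]]|/andP[kF gF]]; last by exists n, F.
pose P (H : {n & cnf n}) := is_kCNF k (projT2 H) && gt_majority (projT2 H).
have PG : P (existT cnf m G) by apply/andP.
by move: PG; rewrite -e.
Qed.

(* Main.v *)
(** Branching on a list [S] of variables replaces a formula [F] by [2 ^ size S]
    restrictions whose numbers of models add up to [2 ^ size S] times that of [F].
    Let the remainder of [S] be the number of models of the restrictions that are
    not yet empty (an empty CNF is true). By induction on the width, every k-CNF has
    a list [S] of bounded size whose remainder is as small as one wishes compared
    with the granularity [2 ^ - size S]: either some hitting set of the widest
    clauses has bounded size, and branching on it decreases the width, or the
    formula has very few models. For a 3-CNF with more than half of the assignments
    as models, the empty restrictions then number at least half of all restrictions,
    and if they number exactly half, then some nonempty restriction, which is a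
    2-CNF, is satisfiable. So it suffices to try all lists [S] of at most [c]
    variables, with a constant [c], and to solve polynomially many 2-SAT instances
    by eliminating variables.

    Running times are bounded on a machine with five stacks, each of which is a
    tape of a Turing machine. Data are binary trees in Polish notation, so that
    functions act on the top of one stack and compose without bookkeeping. *)

Require Import Defs.
From HB Require Import structures.
From mathcomp Require Import all_boot all_order all_algebra zify.

Set Implicit Arguments.
Unset Strict Implicit.
Unset Printing Implicit Defensive.

(** * Branching on variables *)

(** The obstacle is that the tolerance is measured against the list still to be found: a longer list
    has a finer granularity. Hence approximation is stated for an arbitrary tolerance function [g]
    of the length, with a bound [c] that depends on [g] alone, and when lists are concatenated the
    tolerance for the first already allows for the length of the second. The dichotomy is greedy. As
    long as a clause is left unhit, branching on its at most [k] variables falsifies it in at least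
    one of at most [2 ^ k] cases; [t] such rounds leave at most the fraction [(1 - 1 / 2 ^ k) ^ t]
    of all assignments as models. A tautology cannot be falsified, so tautologies are removed before
    the test. Restrictions are counted over all [n] variables, so an empty one weighs exactly
    [2 ^ n]. By integrality, a remainder below [2 ^ n / 2] cannot lift fewer than half of the
    restrictions above one half of the total. A positive answer is correct for whatever list
    produced it; approximation is what guarantees that some list of bounded length gives one. *)

Definition formula (V : Type) : Type := seq (seq (bool * V)).

Definition vars (V : Type) (F : formula V) : seq V := [seq l.2 | l <- flatten F].

Definition fix_var (V : eqType) (b : bool) (x : V) (F : formula V) : formula V :=
  [seq [seq l <- C | l.2 != x] | C <- F & (b, x) \notin C].

Definition split_var (V : eqType) (x : V) (Fs : seq (formula V)) : seq (formula V) :=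
  flatten [seq [:: fix_var true x F; fix_var false x F] | F <- Fs].

Definition branch (V : eqType) (S : seq V) (F : formula V) : seq (formula V) :=
  foldl (fun Fs x => split_var x Fs) [:: F] S.

Definition tautology (V : eqType) (C : seq (bool * V)) : bool :=
  has (fun l => (~~ l.1, l.2) \in C) C.

Definition width_le (k : nat) (V : Type) (F : formula V) : bool :=
  all (fun C => size C <= k) F.

Definition tautology_free (V : eqType) (F : formula V) : bool :=
  all (fun C => ~~ tautology C) F.

Section Branching.
Variable V : eqType.
Implicit Types (F G : formula V) (S : seq V) (x : V).

Lemma split_var_cat x (Fs Gs : seq (formula V)) :
  split_var x (Fs ++ Gs) = split_var x Fs ++ split_var x Gs.
Proof. by rewrite /split_var map_cat flatten_cat. Qed.

Lemma foldl_split_cat S (Fs Gs : seq (formula V)) :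
  foldl (fun Fs x => split_var x Fs) (Fs ++ Gs) S =
  foldl (fun Fs x => split_var x Fs) Fs S ++ foldl (fun Fs x => split_var x Fs) Gs S.
Proof. by elim: S Fs Gs => //= x S IH Fs Gs; rewrite split_var_cat IH. Qed.

Lemma branch_cons x S F :
  branch (x :: S) F = branch S (fix_var true x F) ++ branch S (fix_var false x F).
Proof. by rewrite /branch /= -[RHS]foldl_split_cat. Qed.

Lemma branch_rcons x S F : branch (rcons S x) F = split_var x (branch S F).
Proof. by rewrite /branch -cats1 foldl_cat. Qed.

Lemma branch_cat S1 S2 F :
  branch (S1 ++ S2) F = flatten [seq branch S2 G | G <- branch S1 F].
Proof.
elim: S1 F => [|x S1 IH] F; first by rewrite /= cats0.
by rewrite cat_cons !branch_cons !IH map_cat flatten_cat.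
Qed.

Lemma size_branch S F : size (branch S F) = 2 ^ size S.
Proof.
elim: S F => //= x S IH F.
by rewrite branch_cons size_cat !IH addnn -mul2n expnS.
Qed.

Lemma branch_nil S : branch S [::] = nseq (2 ^ size S) [::].
Proof.
by elim: S => //= x S IH; rewrite branch_cons IH -nseqD addnn -mul2n expnS.
Qed.

Lemma fix_varC b b' x y F : x != y ->
  fix_var b x (fix_var b' y F) = fix_var b' y (fix_var b x F).
Proof.
move=> xy; rewrite /fix_var !filter_map -!map_comp -!filter_predI.
rewrite (eq_map (g := fun C => [seq l <- [seq l <- C | l.2 != x] | l.2 != y])); last first.
  by move=> C /=; rewrite -!filter_predI; apply: eq_filter => l /=; rewrite andbC.
congr map; apply: eq_filter => C /=.
by rewrite !mem_filter /= xy eq_sym xy /= andbC.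
Qed.

(** After the first fixing no literal on [x] is left. Lists of variables may therefore contain
    repetitions: a repeated variable merely doubles each restriction. *)
Lemma fix_var_id b b' x F : fix_var b x (fix_var b' x F) = fix_var b' x F.
Proof.
rewrite /fix_var !filter_map -!map_comp -!filter_predI.
rewrite (@eq_filter _ _ (fun C => (b', x) \notin C)); last first.
  by move=> C /=; rewrite mem_filter /= eqxx.
apply: eq_map => C /=; rewrite -filter_predI.
by apply: eq_filter => l /=; rewrite andbb.
Qed.

Lemma fix_var_width k b x F : width_le k F -> width_le k (fix_var b x F).
Proof.
move=> /allP wF; apply/allP => _ /mapP[C + ->]; rewrite mem_filter => /andP[_ /wF].
by apply: leq_trans; rewrite size_filter count_size.
Qed.

Lemma fix_var_tautology_free b x F : tautology_free F -> tautology_free (fix_var b x F).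
Proof.
move=> /allP tF; apply/allP => _ /mapP[C + ->]; rewrite mem_filter => /andP[_ /tF].
apply: contra => /hasP[l]; rewrite !mem_filter => /andP[_ lC] /andP[_ nlC].
by apply/hasP; exists l.
Qed.

Lemma vars_fix_var b x F : {subset vars (fix_var b x F) <= vars F}.
Proof.
move=> _ /mapP[l /flattenP[_ /mapP[C + ->] +] ->].
rewrite !mem_filter => /andP[_ CF] /andP[_ lC].
by apply: map_f; apply/flattenP; exists C.
Qed.

Lemma branch_ind (P : formula V -> Prop) S F :
    (forall b x G, P G -> P (fix_var b x G)) -> P F ->
  forall G, G \in branch S F -> P G.
Proof.
move=> Pfix; elim: S F => [|x S IH] F PF G; first by rewrite inE => /eqP ->.
by rewrite branch_cons mem_cat => /orP[]; apply: IH; apply: Pfix.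
Qed.

(** Fixing a variable outside [C] neither satisfies nor shortens it. This transfers a hitting set of
    a restriction back to [F]. *)
Lemma branch_unhit S F C G : C \in F -> ~~ has [in S] (map snd C) ->
  G \in branch S F -> C \in G.
Proof.
elim: S F => [|x S IH] F CF CS; first by rewrite inE => /eqP ->.
have [/negP xC CS'] : x \notin map snd C /\ ~~ has [in S] (map snd C).
  split; apply: contra CS.
    by move=> xC; apply/hasP; exists x; rewrite ?inE ?eqxx.
  by case/hasP=> y yC yS; apply/hasP; exists y; rewrite ?inE ?yS ?orbT.
have Cf b : C \in fix_var b x F.
  apply/mapP; exists C.
    rewrite mem_filter CF andbT; apply/negP => bxC; apply: xC.
    exact: (map_f snd bxC).
  apply/esym/all_filterP/allP => l lC; apply/eqP => lx.
  by apply: xC; rewrite -lx map_f.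
by rewrite branch_cons mem_cat => /orP[]; apply: IH.
Qed.

Lemma branch_hit k S F : width_le k.+1 F ->
  (forall C, C \in F -> has [in S] (map snd C)) ->
  forall G, G \in branch S F -> width_le k G.
Proof.
(* The hypothesis is weakened to clauses of full width [k.+1]. A shortened clause may lose the
   literal that was hit, but its width is then at most [k] for good, so the weaker form survives the
   induction. *)
have : (forall C, C \in F -> has [in S] (map snd C)) ->
       (forall C, C \in F -> size C == k.+1 -> has [in S] (map snd C)).
  by move=> H C /H.
move=> + wF hS => /(_ hS) {hS}.
elim: S F wF => [|x S IH] F wF hS G.
  rewrite inE => /eqP ->; apply/allP => C CF.
  have := allP wF C CF; rewrite leq_eqVlt => /orP[/(hS C CF)|//].
  by case/hasP.
(* A clause of full width in the restriction was not shortened, hence avoids [x] and is hit by the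
   rest of the list. *)
have hf b C : C \in fix_var b x F -> size C == k.+1 -> has [in S] (map snd C).
  move=> /mapP[D]; rewrite mem_filter => /andP[_ DF] -> sD.
  have e : [seq l <- D | l.2 != x] = D.
    apply/all_filterP; rewrite all_count eqn_leq count_size /= -size_filter (eqP sD).
    exact: (allP wF).
  move: sD; rewrite e => /(hS D DF) /hasP[y yD]; rewrite inE => /orP[/eqP yx|yS].
    move: yD; rewrite yx -e => /mapP[l]; rewrite mem_filter => /andP[/eqP + _] xl.
    by rewrite -xl.
  by apply/hasP; exists y.
by rewrite branch_cons mem_cat => /orP[]; apply: IH; by [apply: fix_var_width | apply: hf].
Qed.

Lemma branch_falsify S F C : C \in F -> ~~ tautology C ->
  {subset map snd C <= S} -> exists2 G, G \in branch S F & [::] \in G.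
Proof.
elim: S F C => [|x S IH] F C CF tC sC.
  exists F; first by rewrite inE.
  by case: C CF tC sC => // l C _ _ /(_ l.2); rewrite inE eqxx => /(_ isT).
(* Not being a tautology, [C] lacks one of the two literals on [x]. The corresponding value does not
   satisfy [C], which thus shrinks along the list to the empty clause. *)
have [b bC] : exists b, (b, x) \notin C.
  case: (boolP ((true, x) \in C)) => [h|]; last by exists true.
  exists false; apply: contra tC => h'; apply/hasP; exists (true, x) => //.
have [|||G G1 G2] := IH (fix_var b x F) [seq l <- C | l.2 != x].
- by apply: map_f; rewrite mem_filter bC.
- apply: contra tC => /hasP[l]; rewrite !mem_filter => /andP[_ lC] /andP[_ nlC].
  by apply/hasP; exists l.
- move=> y /mapP[l]; rewrite mem_filter => /andP[lx lC] ->.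
  by have := sC _ (map_f snd lC); rewrite inE (negPf lx).
exists G => //; rewrite branch_cons mem_cat.
by case: b {bC} G1 => ->; rewrite ?orbT.
Qed.

End Branching.

(** * Counting models along a branching *)

Lemma num_satE n (F : cnf n) : num_sat F = \sum_(a : assignment n) cnf_sat a F.
Proof. by rewrite /num_sat cardsE -sum1_card big_mkcond. Qed.

Definition update (n : nat) (a : assignment n) (x : 'I_n) (b : bool) : assignment n :=
  [ffun i => if i == x then b else a i].

Lemma cnf_sat_fix_var n (a : assignment n) b x (F : cnf n) :
  cnf_sat a (fix_var b x F) = cnf_sat (update a x b) F.
Proof.
rewrite /cnf_sat /fix_var all_map all_filter; apply: eq_in_all => C CF /=.
apply/implyP/hasP => [h|[l lC]].
  case: (boolP ((b, x) \in C)) => bC.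
    by exists (b, x) => //; rewrite /lit_sat ffunE eqxx /=.
  have /hasP[l] := h bC; rewrite mem_filter => /andP[lx lC] al.
  by exists l => //; rewrite /lit_sat ffunE (negPf lx).
rewrite /lit_sat ffunE; case: (l.2 =P x) => [lx /eqP lb | /eqP lx al _].
  by rewrite -lx lb -surjective_pairing lC.
by apply/hasP; exists l; rewrite ?mem_filter ?lx.
Qed.

(** A fixed variable is still counted, as a free one, hence the factor 2. The assignments
    [update a x true] and [update a x false] are [a] and its flip at [x] in some order, and flipping
    permutes the assignments. *)
Lemma num_sat_split n (x : 'I_n) (F : cnf n) :
  num_sat (fix_var true x F) + num_sat (fix_var false x F) = 2 * num_sat F.
Proof.
rewrite !num_satE -big_split /=.
pose flip (a : assignment n) := update a x (~~ a x).
have flipK : involutive flip.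
  by move=> a; apply/ffunP => i; rewrite !ffunE eqxx negbK; case: eqP => [->|].
have e2 : \sum_a cnf_sat (flip a) F = \sum_a cnf_sat a F.
  by rewrite [RHS](reindex_inj (inv_inj flipK)).
rewrite mul2n -addnn -{2}e2 -big_split /=.
apply: eq_bigr => a _; rewrite !cnf_sat_fix_var.
have e b : a x = b -> update a x b = a.
  by move=> <-; apply/ffunP => i; rewrite ffunE; case: eqP => [->|].
by rewrite /flip; case ax: (a x); rewrite (e _ ax) // addnC.
Qed.

Lemma num_sat_nil n : num_sat ([::] : cnf n) = 2 ^ n.
Proof.
rewrite /num_sat (_ : [set a | _] = setT); last by apply/setP => a; rewrite !inE.
by rewrite cardsT card_ffun card_bool card_ord.
Qed.

Lemma num_sat_le n (F : cnf n) : num_sat F <= 2 ^ n.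
Proof.
rewrite -num_sat_nil !num_satE; apply: leq_sum => a _.
by rewrite [cnf_sat a [::]]/= leq_b1.
Qed.

Lemma num_sat_branch n S (F : cnf n) :
  \sum_(G <- branch S F) num_sat G = 2 ^ size S * num_sat F.
Proof.
elim: S F => [|x S IH] F; first by rewrite big_seq1 mul1n.
by rewrite branch_cons big_cat /= !IH -mulnDr num_sat_split expnS mulnCA mulnA.
Qed.

(* [2 ^ size S] times the number of models of [F] whose restriction to [S] does
   not already satisfy [F]. *)
Definition remainder n (S : seq 'I_n) (F : cnf n) : nat :=
  \sum_(G <- branch S F | G != [::]) num_sat G.

Lemma remainder_le n S (F : cnf n) : remainder S F <= 2 ^ size S * num_sat F.
Proof.
by rewrite -num_sat_branch [X in _ <= X](bigID (fun G => G != [::])) leq_addr.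
Qed.

Lemma remainder_cat n S1 S2 (F : cnf n) :
  remainder (S1 ++ S2) F = \sum_(G <- branch S1 F) remainder S2 G.
Proof. by rewrite /remainder branch_cat big_flatten /= big_map. Qed.

Lemma remainder_nil n (S : seq 'I_n) : remainder S [::] = 0.
Proof. by rewrite /remainder branch_nil big_nseq_cond eqxx. Qed.

(** Empty restrictions stay empty under further branching, so only the nonempty ones contribute,
    each with at most all its models. *)
Lemma remainder_catl n S1 S2 (F : cnf n) :
  remainder (S1 ++ S2) F <= 2 ^ size S2 * remainder S1 F.
Proof.
rewrite remainder_cat /remainder big_distrr /= [X in _ <= X]big_mkcond /=.
apply: leq_sum => G _; case: eqP => [->|_]; first by rewrite -/(remainder S2 _) remainder_nil.
exact: remainder_le.
Qed.

Lemma remainder_cons n x S (F : cnf n) :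
  remainder (x :: S) F = remainder S (fix_var true x F) + remainder S (fix_var false x F).
Proof. by rewrite /remainder branch_cons big_cat. Qed.

(** Fixings of distinct variables commute, so [x] can be moved behind [S], where [remainder_catl]
    applies; if [x] occurs in [S], its second fixing has no effect. *)
Lemma remainder_cons_le n x S (F : cnf n) : remainder (x :: S) F <= 2 * remainder S F.
Proof.
elim: S F => [|y S IH] F; first by have := remainder_catl [::] [:: x] F.
move: IH; rewrite !remainder_cons => IH.
have [<-|yx] := eqVneq y x; first by rewrite !fix_var_id; lia.
rewrite ![fix_var _ y (fix_var _ x F)]fix_varC //.
have := IH (fix_var true y F); have := IH (fix_var false y F).
rewrite !remainder_cons; lia.
Qed.

Lemma remainder_catr n S1 S2 (F : cnf n) :
  remainder (S1 ++ S2) F <= 2 ^ size S1 * remainder S2 F.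
Proof.
elim: S1 F => [|x S1 IH] F; first by rewrite mul1n.
rewrite cat_cons (leq_trans (remainder_cons_le _ _ _)) //= expnS -mulnA.
by rewrite leq_mul2l IH.
Qed.

(** * Approximation by branching on few variables *)

Lemma cnf_sat_falsified n (a : assignment n) (F : cnf n) : [::] \in F -> cnf_sat a F = false.
Proof. by move=> F0; apply/negP => /allP/(_ _ F0). Qed.

Lemma num_sat_falsified n (F : cnf n) : [::] \in F -> num_sat F = 0.
Proof. by move=> F0; rewrite num_satE big1 // => a _; rewrite cnf_sat_falsified. Qed.

Lemma vars_branch (V : eqType) (S : seq V) (F G : formula V) :
  G \in branch S F -> {subset vars G <= vars F}.
Proof.
apply (@branch_ind V (fun H => {subset vars H <= vars F}) S F) => // b x H HF y.
by move=> /vars_fix_var; apply: HF.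
Qed.

Lemma branch_width k (V : eqType) (S : seq V) (F G : formula V) :
  width_le k F -> G \in branch S F -> width_le k G.
Proof.
move=> wF; apply (@branch_ind V (fun H => width_le k H) S F) => // b x H.
exact: fix_var_width.
Qed.

Lemma branch_tautology_free (V : eqType) (S : seq V) (F G : formula V) :
  tautology_free F -> G \in branch S F -> tautology_free G.
Proof.
move=> tF; apply (@branch_ind V (fun H => tautology_free H) S F) => // b x H.
exact: fix_var_tautology_free.
Qed.

(* If some clause [C] is present, branching on its variables leaves at least one
   falsified formula among [2 ^ size C]; either one of the others still has a
   clause untouched by a hitting set of bounded size, or all have few models. *)
Lemma few_models_or_hitting k t n (F : cnf n) : width_le k F -> tautology_free F ->
  num_sat F * (2 ^ k) ^ t <= (2 ^ k).-1 ^ t * 2 ^ n \/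
  exists S, [/\ size S <= k * t, {subset S <= vars F} &
                forall C, C \in F -> has [in S] (map snd C)].
Proof.
elim: t F => [|t IH] F wF tF; first by left; rewrite !expn0 muln1 mul1n num_sat_le.
case: F wF tF => [|C F] wF tF; first by right; exists [::].
set F' := C :: F; have CF : C \in F' by rewrite inE eqxx.
have wC : size C <= k by apply: (allP wF).
have tC : ~~ tautology C by apply: (allP tF).
pose small (G : cnf n) := num_sat G * (2 ^ k) ^ t <= (2 ^ k).-1 ^ t * 2 ^ n.
have [/allP all_small | /allPn[G GB nG]] := boolP (all small (branch (map snd C) F')).
  (* The falsified restriction [G0] has no model, and each of the other [(2 ^ s).-1] restrictions
     satisfies the bound for [t]. *)
  left; have [G0 G0B G00] := branch_falsify CF tC (fun _ => id).
  have := num_sat_branch (map snd C) F'.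
  rewrite (perm_big _ (perm_to_rem G0B)) big_cons /= num_sat_falsified // add0n size_map.
  set s := size C in wC * => e.
  have sz : size (rem G0 (branch (map snd C) F')) = (2 ^ s).-1.
    by rewrite size_rem // size_branch size_map.
  have : 2 ^ s * num_sat F' * (2 ^ k) ^ t <= (2 ^ s).-1 * ((2 ^ k).-1 ^ t * 2 ^ n).
    rewrite -e big_distrl /= -sz -sum1_size big_distrl /=.
    rewrite big_seq [X in _ <= X]big_seq.
    by apply: leq_sum => G /mem_rem GB; rewrite mul1n; apply: all_small.
  have : 2 ^ s <= 2 ^ k by rewrite leq_exp2l.
  have : 0 < 2 ^ s by rewrite expn_gt0.
  (* One more round costs the factor [u.-1 / u], which is at most [K.-1 / K] because [u <= K];
     denominators are cleared by multiplying with [u]. *)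
  move=> u_gt0 uK; rewrite -mulnA => h; rewrite !expnS -mulnA [leqLHS]mulnCA.
  move: (2 ^ s) (2 ^ k) (_ ^ t * 2 ^ n) (num_sat F' * _) u_gt0 uK h => u K Q N u_gt0 uK h.
  rewrite -(leq_pmul2l u_gt0) mulnCA (leq_trans (leq_mul (leqnn K) h)) // !mulnA.
  by rewrite leq_mul2r; apply/orP; right; nia.
have wG : width_le k G by apply: branch_width wF GB.
have tG : tautology_free G by exact: branch_tautology_free tF GB.
have [sm|[S [sS vS hS]]] := IH G wG tG; first by rewrite /small sm in nG.
(* A clause disjoint from [C] passes unchanged to [G], where [S] hits it; all other clauses are hit
   by the variables of [C]. *)
right; exists (map snd C ++ S); split.
- by rewrite size_cat size_map mulnS leq_add.
- move=> x; rewrite mem_cat => /orP[xC|/vS/(vars_branch GB)//].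
  by rewrite /vars /= map_cat mem_cat xC.
move=> D DF; case: (boolP (has [in map snd C] (map snd D))) => [|hD].
  by apply: sub_has => x /= xC; rewrite mem_cat xC.
have := hS D (branch_unhit DF hD GB).
by apply: sub_has => x /= xS; rewrite mem_cat xS orbT.
Qed.

(** Bernoulli's inequality with denominators cleared. It supplies the number of rounds that pushes
    the proportion of models below [1 / g]. *)
Lemma expn_ratio_unbounded g M : {t | g * M ^ t < M.+1 ^ t}.
Proof.
case: M => [|M]; first by exists 1; rewrite muln0.
(* With this exponent the Bernoulli factor [M.+1 + t] equals [g.+1 * M.+1], and [M.+1] cancels. *)
exists (g * M.+1).
have bernoulli t : M.+1 ^ t * (M.+1 + t) <= M.+2 ^ t * M.+1.
  elim: t => [|t IH]; first by rewrite !expn0 addn0.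
  rewrite !expnS; move: (M.+1 ^ t) (M.+2 ^ t) IH => X Y IH; nia.
have := bernoulli (g * M.+1).
rewrite -[X in X + _]mul1n -mulnDl mulnA leq_pmul2r // => h.
apply: leq_trans h; rewrite mulnC ltn_pmul2l ?expn_gt0 //.
Qed.

(** As a proportion of [2 ^ size S * 2 ^ n], each remainder is below [1 / g (size S)]. The variables
    are confined to those of the formulas because [branchings] enumerates only such lists. *)
Definition approximable (n c : nat) (g : nat -> nat) (Fs : seq (cnf n)) (S : seq 'I_n) :=
  [/\ size S <= c, {subset S <= flatten (map (@vars _) Fs)} &
      forall F, F \in Fs -> remainder S F * g (size S) < 2 ^ size S * 2 ^ n].

Lemma sum_upto (g : nat -> nat) m i : i <= m -> g i <= \sum_(j < m.+1) g j.
Proof. by move=> im; rewrite (bigD1 (inord i)) //= inordK // leq_addr. Qed.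

(* The choice of [c] precedes that of the formula although the tolerance
   [1 / g (size S)] depends on the set [S] found. *)
Lemma approximable_seq k :
  (forall g, {c | forall n (F : cnf n), width_le k F -> tautology_free F ->
     exists S, approximable c g [:: F] S}) ->
  forall N g, {c | forall n (Fs : seq (cnf n)), size Fs <= N ->
     (forall F, F \in Fs -> width_le k F /\ tautology_free F) ->
     exists S, approximable c g Fs S}.
Proof.
move=> H1; elim=> [|N IH] g.
  by exists 0 => n [|F Fs] // _ _; exists [::]; split.
(* Sums serve as monotone majorants of [g]. [S1] is found first, with a tolerance [g1] that allows
   for the bound [c2] on the list found afterwards; the tolerance [g2] of that second list knows the
   actual length of [S1]. *)
pose g2 s t := \sum_(j < (s + t).+1) g j.
pose c2 s := sval (IH (g2 s)).
pose g1 s := \sum_(j < (s + c2 s).+1) g j.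
pose c1 := sval (H1 g1).
exists (\sum_(s < c1.+1) (s + c2 s)) => n [|F Fs] szF wt.
  by exists [::]; split.
have [wF tF] := wt F (mem_head _ _).
have [S1 [s1 v1 r1]] := svalP (H1 g1) n F wF tF.
have [|S2 [s2 v2 r2]] := svalP (IH (g2 (size S1))) n Fs szF.
  by move=> G GFs; apply: wt; rewrite inE GFs orbT.
exists (S1 ++ S2); split.
- rewrite size_cat; apply: leq_trans (@sum_upto (fun s => s + c2 s) c1 (size S1) s1).
  by rewrite leq_add2l.
- move=> x; rewrite mem_cat /= mem_cat => /orP[/v1|/v2 ->]; last by rewrite orbT.
  by rewrite /= cats0 => ->.
have n0 : 0 < 2 ^ n by rewrite expn_gt0.
(* Another [m] variables enlarge the remainder by at most the factor [2 ^ m], by which the allowance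
   grows as well. *)
have scale (S : seq 'I_n) u r v : r * u < 2 ^ size S * 2 ^ n -> v <= u -> forall m R, R <= 2 ^ m * r ->
    R * v < 2 ^ (size S + m) * 2 ^ n.
  move=> ru vu m R Rr.
  apply: leq_ltn_trans (leq_mul Rr vu) _.
  by rewrite addnC expnD -!mulnA ltn_pmul2l ?expn_gt0.
move=> G; rewrite inE size_cat => /orP[/eqP ->|/r2 rG].
  have rF := r1 F (mem_head _ _).
   apply: (scale _ _ _ _ rF _ _ _ (remainder_catl _ _ _)).
  by apply: (@sum_upto g); rewrite leq_add2l.
rewrite [X in 2 ^ X]addnC; apply: (scale _ _ _ _ rG); last exact: remainder_catr.
exact: (@sum_upto g).
Qed.

(** The alternative is for the majority test: with a suitable [g 0], few models contradict the
    majority, and otherwise the restrictions are narrow enough for 2-SAT. In the induction, a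
    hitting set lowers the width of all restrictions, which are then approximated by one common
    list. *)
Lemma approximable_width k g :
  {c | forall n (F : cnf n), width_le k F -> tautology_free F -> exists S,
     approximable c g [:: F] S /\
     (g 0 * num_sat F < 2 ^ n \/ forall G, G \in branch S F -> width_le k.-1 G)}.
Proof.
elim: k g => [|k IH] g.
  exists 0 => n [|C F] wF _; exists [::]; (split; first split=> //).
  - by move=> F; rewrite inE => /eqP ->; rewrite remainder_nil mul0n muln_gt0 !expn_gt0.
  - by right=> G; rewrite inE => /eqP ->.
  - move=> G; rewrite inE => /eqP ->.
    have F0 : [::] \in C :: F by move: wF => /= /andP[]; rewrite leqn0 size_eq0 eq_sym inE => ->.
    rewrite (@leq_ltn_trans 0) ?muln_gt0 ?expn_gt0 // leqn0 muln_eq0 -leqn0.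
    by rewrite (leq_trans (remainder_le _ _)) // num_sat_falsified // muln0.
  - have F0 : [::] \in C :: F by move: wF => /= /andP[]; rewrite leqn0 size_eq0 eq_sym inE => ->.
    by left; rewrite num_sat_falsified // muln0 expn_gt0.
(* After [t] rounds the proportion of models is below [1 / g 0], so that the empty list will do;
   otherwise there is a hitting set of size at most [h]. *)
have [t gt] := expn_ratio_unbounded (g 0) (2 ^ k.+1).-1.
rewrite prednK ?expn_gt0 // in gt.
pose h := k.+1 * t.
have IH1 g' : {c | forall n (F : cnf n), width_le k F -> tautology_free F ->
    exists S, approximable c g' [:: F] S}.
  by have [c cP] := IH g'; exists c => n F wF tF; have [S []] := cP n F wF tF; exists S.
(* There are at most [2 ^ h] restrictions, and the tolerance allows for up to [h] variables put in
   front of the new list. *)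
have [c cP] := approximable_seq IH1 (2 ^ h) (fun s => \sum_(j < (h + s).+1) g j).
exists (h + c) => n F wF tF.
have [small|[S1 [s1 v1 h1]]] := few_models_or_hitting t wF tF.
  have gF : g 0 * num_sat F < 2 ^ n.
    rewrite -(@ltn_pmul2r ((2 ^ k.+1) ^ t)) ?expn_gt0 // -mulnA.
    apply: leq_ltn_trans (leq_mul (leqnn _) small) _.
    by rewrite mulnA [ltnRHS]mulnC ltn_pmul2r ?expn_gt0.
  exists [::]; split; last by left.
  split=> // G; rewrite inE => /eqP -> /=; rewrite mul1n; apply: leq_ltn_trans gF.
  by rewrite mulnC leq_mul2l; apply/orP; right; have := remainder_le [::] F; rewrite mul1n.
have [||S2 [s2 v2 r2]] := cP n (branch S1 F).
- by rewrite size_branch leq_exp2l.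
- by move=> G GB; split; [apply: (branch_hit wF h1) | apply: branch_tautology_free GB].
exists (S1 ++ S2); split; last first.
  right=> G; rewrite branch_cat => /flattenP[_ /mapP[G1 G1B ->]].
  by apply: branch_width; apply: branch_hit wF h1 _ G1B.
split.
- by rewrite size_cat leq_add.
- move=> x; rewrite /= cats0 mem_cat => /orP[/v1//|/v2/flattenP[_ /mapP[G GB ->]]].
  exact: (vars_branch GB).
move=> G; rewrite inE => /eqP -> {G}.
rewrite remainder_cat size_cat expnD -(size_branch S1 F) -mulnA -(sum1_size (branch S1 F)).
rewrite !big_distrl /=.
rewrite [ltnRHS](eq_bigr (fun=> 2 ^ size S2 * 2 ^ n)) => [|? _]; last by rewrite mul1n.
(* Strict inequalities add up to a strict one only over a nonempty list. *)
have : branch S1 F != [::] by rewrite -size_eq0 size_branch -lt0n expn_gt0.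
have gS : g (size S1 + size S2) <= \sum_(j < (h + size S2).+1) g j.
  by apply: (@sum_upto g); rewrite leq_add2r.
elim: (branch S1 F) r2 => // G Gs IHs r2 _.
have rG : remainder S2 G * g (size S1 + size S2) < 2 ^ size S2 * 2 ^ n.
  apply: leq_ltn_trans (r2 G (mem_head _ _)); exact: leq_mul.
rewrite !big_cons; case: (Gs =P [::]) => [->|/eqP Gs0].
  by rewrite !big_nil !addn0.
rewrite -addSn; apply: leq_add rG _; apply/ltnW/IHs => // H HGs.
by apply: r2; rewrite inE HGs orbT.
Qed.

(** * The majority test *)

Definition drop_var (V : eqType) (x : V) (C : seq (bool * V)) : seq (bool * V) :=
  [seq l <- C | l.2 != x].

(** Davis-Putnam elimination: the resolvents on [x] replace the clauses containing it. Clauses with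
    both literals on [x] are always true and disappear. Removing duplicates bounds the length by the
    number of possible clauses. *)
Definition eliminate (V : eqType) (x : V) (F : formula V) : formula V :=
  undup ([seq C <- F | x \notin map snd C] ++
         [seq drop_var x C ++ drop_var x D |
            C <- [seq C <- F | ((true, x) \in C) && ((false, x) \notin C)],
            D <- [seq D <- F | ((false, x) \in D) && ((true, x) \notin D)]]).

(** Under the first conjunct the filter is the identity. It keeps the fold small on wider formulas
    too, since the second conjunct has to be computable in polynomial time on every input. *)
Definition two_sat (V : eqType) (F : formula V) : bool :=
  width_le 2 F &&
  ([::] \notin foldl (fun G x => eliminate x G) (undup [seq C <- F | size C <= 2]) (vars F)).

Definition models (V : eqType) (a : V -> bool) (F : formula V) : bool :=
  all (has (fun l => a l.2 == l.1)) F.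

Lemma has_update (V : eqType) (a : V -> bool) (b : bool) (x : V) (C : seq (bool * V)) :
  has (fun l => (if l.2 == x then b else a l.2) == l.1) C =
  ((b, x) \in C) || has (fun l => a l.2 == l.1) (drop_var x C).
Proof.
apply/hasP/orP => [[l lC]|[bC|/hasP[l]]].
- case: (l.2 =P x) => [<- /eqP ->|lx al]; first by left; rewrite -surjective_pairing.
  by right; apply/hasP; exists l; rewrite ?mem_filter //= lC andbT; apply/eqP.
- by exists (b, x); rewrite //= eqxx.
- by rewrite mem_filter => /andP[lx lC] al; exists l; rewrite //= (negPf lx).
Qed.

Lemma eliminate_models (V : eqType) (x : V) (F : formula V) :
  (exists a, models a F) <-> (exists a, models a (eliminate x F)).
Proof.
pose upd (a : V -> bool) b y := if y == x then b else a y.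
have update_id a C : has (fun l => upd a (a x) l.2 == l.1) C = has (fun l => a l.2 == l.1) C.
  by apply: eq_has => l /=; rewrite /upd; case: (l.2 =P x) => [->|].
split=> -[a]; rewrite /models.
  move=> /allP aF; exists a; rewrite /models (eq_all_r (mem_undup _)) all_cat.
  apply/andP; split.
    by apply/allP => C; rewrite mem_filter => /andP[_]; apply: aF.
  apply/allP => _ /allpairsP[[C D] /= [+ + ->]]; rewrite !mem_filter has_cat.
  move=> /andP[/andP[_ fC] /aF aC] /andP[/andP[_ tD] /aF aD].
  have {}aC : ((a x, x) \in C) || has (fun l => a l.2 == l.1) (drop_var x C).
    by rewrite -has_update (update_id a C).
  have {}aD : ((a x, x) \in D) || has (fun l => a l.2 == l.1) (drop_var x D).
    by rewrite -has_update (update_id a D).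
  apply/orP; move: aC aD; case: (a x) => aC aD.
    by right; rewrite (negPf tD) in aD.
  by left; rewrite (negPf fC) in aC.
rewrite (eq_all_r (mem_undup _)) all_cat => /andP[/allP a1 /allP a2].
(* Setting [x] to [b] is safe once each clause containing only the opposite literal on [x] is
   satisfied by its other literals. *)
have split_by b : (forall C, C \in F -> (~~ b, x) \in C -> (b, x) \notin C ->
    has (fun l => a l.2 == l.1) (drop_var x C)) -> exists a, models a F.
  move=> ab; exists (upd a b); apply/allP => C CF; rewrite has_update.
  case: (boolP ((b, x) \in C)) => //= bC.
  case: (boolP ((~~ b, x) \in C)) => nbC; first exact: ab.
  have xC : x \notin map snd C.
    apply/mapP => -[[c y] lC /= xy]; subst y.
    by case: b c lC bC nbC {ab} => -[] /= ->.
  rewrite (_ : drop_var x C = C); first by apply: a1; rewrite mem_filter xC.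
  apply/all_filterP/allP => l lC; apply: contra xC => /eqP <-; exact: map_f.
(* If all clauses with only the negative literal are satisfied without [x], make [x] true. Otherwise
   some such [D] is not, and its resolvents force each clause with only the positive literal to be
   satisfied without [x], which can then be false. *)
case: (boolP (all (fun D => has (fun l => a l.2 == l.1) (drop_var x D))
                [seq D <- F | ((false, x) \in D) && ((true, x) \notin D)])) => [/allP aD|].
  by apply: (split_by true) => D DF fD tD; apply: aD; rewrite mem_filter fD tD.
case/allPn=> D DF naD; apply: (split_by false) => C CF tC fC.
have := a2 (drop_var x C ++ drop_var x D).
rewrite has_cat (negPf naD) orbF; apply.
apply/allpairsP; exists (C, D); split=> //=.
by rewrite mem_filter tC fC.
Qed.

Lemma vars_eliminate (V : eqType) (x y : V) (F : formula V) :
  y \in vars (eliminate x F) -> (y != x) && (y \in vars F).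
Proof.
have varsP (G : formula V) l C : C \in G -> l \in C -> l.2 \in vars G.
  by move=> CG lC; apply: map_f; apply/flattenP; exists C.
case/mapP=> l /flattenP[C]; rewrite mem_undup mem_cat => /orP[|].
  rewrite mem_filter => /andP[xC CF] lC ->; rewrite (varsP F l C) // andbT.
  by apply: contra xC => /eqP <-; apply: map_f.
case/allpairsP=> -[D E] /= [+ + ->]; rewrite !mem_filter => /andP[_ DF] /andP[_ EF].
by rewrite mem_cat !mem_filter => /orP[] /andP[lx lD] ->; rewrite lx /=; apply: varsP lD.
Qed.

(** Once no variable is left, the formula is empty or contains the empty clause. *)
Lemma eliminate_all (V : eqType) (vs : seq V) (F : formula V) : {subset vars F <= vs} ->
  [::] \notin foldl (fun G x => eliminate x G) F vs <-> (exists a, models a F).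
Proof.
elim: vs F => [|x vs IH] F sF /=; last first.
  rewrite eliminate_models; apply: IH => y /vars_eliminate/andP[yx /sF].
  by rewrite inE (negPf yx).
case: F sF => [|[|l C] F] sF; first by split=> // _; exists (fun=> true).
  by rewrite inE; split=> // -[a].
by have := sF l.2; rewrite in_nil /vars /= inE eqxx => /(_ isT).
Qed.

Lemma two_satP (V : eqType) (F : formula V) :
  two_sat F <-> width_le 2 F /\ exists a, models a F.
Proof.
rewrite /two_sat; case: (boolP (width_le 2 F)) => [wF|_]; last by split=> // -[].
rewrite (all_filterP wF) /= eliminate_all; last first.
  move=> _ /mapP[l /flattenP[C + lC] ->]; rewrite mem_undup => CF.
  by apply: map_f; apply/flattenP; exists C.
by split=> [[a aF]|[_ [a aF]]]; [split=> //|]; exists a; move: aF;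
   rewrite /models (eq_all_r (mem_undup _)).
Qed.

(** Enumerates lists of restrictions rather than lists of variables. For fixed [c] they are
    polynomially many, each with at most [2 ^ c] entries. *)
Fixpoint branchings (V : eqType) (c : nat) (F : formula V) : seq (seq (formula V)) :=
  if c is c'.+1 then
    branchings c' F ++ [seq split_var x Fs | x <- vars F, Fs <- branchings c' F]
  else [:: [:: F]].

Definition balance_test (V : eqType) (Fs : seq (formula V)) : bool :=
  let good := [seq F <- Fs | nilp F] in
  let bad := [seq F <- Fs | ~~ nilp F] in
  (size bad < size good) || (size bad == size good) && has (@two_sat V) bad.

Definition majority_test (V : eqType) (c : nat) (F : formula V) : bool :=
  has (@balance_test V) (branchings c F).

Lemma branchingsP (V : eqType) (c : nat) (F : formula V) Fs :
  reflect (exists S, [/\ size S <= c, {subset S <= vars F} & Fs = branch S F])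
          (Fs \in branchings c F).
Proof.
apply: (iffP idP) => [|[S [sS vS ->]]].
  elim: c Fs => [|c IH] Fs /=; first by rewrite inE => /eqP ->; exists [::]; split.
  rewrite mem_cat => /orP[/IH[S [sS vS ->]]|].
    by exists S; split=> //; apply: leqW.
  case/allpairsP=> -[x Gs] /= [xF /IH[S [sS vS ->]] ->].
  exists (rcons S x); rewrite size_rcons branch_rcons; split=> // y.
  by rewrite mem_rcons inE => /orP[/eqP ->|/vS].
elim: c S sS vS => [|c IH] S; first by case: S => // _ _; rewrite inE.
case/lastP: S => [|S x] sS vS; rewrite /= mem_cat; first by rewrite IH.
apply/orP; right; apply/allpairsP; exists (x, branch S F); split=> /=.
- by apply: vS; rewrite mem_rcons mem_head.
- by apply: IH => [|y yS]; [rewrite size_rcons in sS | apply: vS; rewrite mem_rcons inE yS orbT].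
- exact: branch_rcons.
Qed.

Lemma num_sat_gt0 n (F : cnf n) : 0 < num_sat F <-> exists a : 'I_n -> bool, models a F.
Proof.
split=> [|[a aF]].
  by case/card_gt0P=> a; rewrite inE => aF; exists a.
apply/card_gt0P; exists [ffun i => a i]; rewrite inE /cnf_sat; move: aF.
by apply: sub_all => C; apply: sub_has => l; rewrite /lit_sat ffunE.
Qed.

Lemma num_sat_balance n S (F : cnf n) :
  2 ^ size S * num_sat F = count (@nilp _) (branch S F) * 2 ^ n + remainder S F.
Proof.
rewrite -num_sat_branch (bigID (@nilp _)) /= /remainder; congr (_ + _).
  rewrite -sum1_count big_distrl /=; apply: eq_bigr => G /nilP ->.
  by rewrite num_sat_nil mul1n.
by apply: eq_bigl => G; rewrite /nilp size_eq0.
Qed.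

(** Covers every [S] and every width, as [two_sat] rejects wider formulas. In a tie the empty
    restrictions account for exactly half of the total, and a model of a nonempty one tips the
    scale. *)
Lemma balance_test_sound n S (F : cnf n) : balance_test (branch S F) -> gt_majority F.
Proof.
have := num_sat_balance S F; have := size_branch S F.
rewrite -(count_predC (@nilp _)) /balance_test !size_filter /gt_majority.
have P0 : 0 < 2 ^ n by rewrite expn_gt0.
have Q0 : 0 < 2 ^ size S by rewrite expn_gt0.
set good := count _ _; set bad := count _ _ => e1 e2.
rewrite -[2 ^ n < _](ltn_pmul2l Q0) mulnCA e2.
move=> /orP[lt|/andP[/eqP eq /hasP[G]]].
  rewrite -e1; move: (2 ^ n) (remainder _ _) P0 => P R P0.
  have : (good + bad).+1 <= 2 * good by lia.
  by nia.
rewrite mem_filter => /andP[Gn GB] /two_satP[_ /num_sat_gt0 G0].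
have : 0 < remainder S F.
  rewrite /remainder (perm_big _ (perm_to_rem GB)) big_cons.
  by rewrite -size_eq0 -/(nilp _) Gn ltn_addr.
rewrite -e1 [X in _ + X]eq; move: (2 ^ n) (remainder _ _) P0 => P R P0.
by nia.
Qed.

Lemma majority_testP : {c | forall n (F : cnf n), width_le 3 F -> tautology_free F ->
  majority_test c F = gt_majority F}.
Proof.
(* This tolerance gives [2 * remainder S F < 2 ^ n], so the remainder is less than half the weight
   of one empty restriction. Its value 2 at length 0 makes the case of few models contradict the
   majority. *)
have [c cP] := approximable_width 3 (fun s => 2 * 2 ^ s); exists c => n F wF tF.
apply/idP/idP => [/hasP[_ /branchingsP[S [_ _ ->]]]|maj]; first exact: balance_test_sound.
have [S [[sS vS rS] [few|hS]]] := cP n F wF tF.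
  by move: maj few; rewrite /gt_majority expn0 muln1; lia.
rewrite /= cats0 in vS; apply/hasP; exists (branch S F).
  by apply/branchingsP; exists S.
have := rS F (mem_head _ _); move: maj.
have := num_sat_balance S F; have := size_branch S F.
rewrite -(count_predC (@nilp _)) /balance_test !size_filter /gt_majority.
have P0 : 0 < 2 ^ n by rewrite expn_gt0.
have Q0 : 0 < 2 ^ size S by rewrite expn_gt0.
set good := count _ _; set bad := count _ _ => e1 e2.
rewrite -[2 ^ n < _](ltn_pmul2l Q0) mulnCA e2 => maj small.
case: ltngtP => //= [gb|gb].
  (* Fewer empty restrictions than others means [2 * good < 2 ^ size S]: after doubling, a deficit
     of at least [2 ^ n], which the remainder cannot cover. *)
  have {}small : 2 * remainder S F < 2 ^ n.
    by rewrite -(ltn_pmul2l Q0) mulnCA [2 ^ size S * _]mulnC mulnCA.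
  exfalso; move: maj small; rewrite -e1; move: (2 ^ n) (remainder _ _) P0 => P R P0; nia.
have R0 : 0 < remainder S F.
  move: maj; rewrite -e1 gb; move: (2 ^ n) (remainder _ _) P0 => P R P0; nia.
move: R0; rewrite /remainder lt0n sum_nat_seq_neq0 => /hasP[G GB /andP[Gn G0]].
apply/hasP; exists G; first by rewrite mem_filter /nilp size_eq0 Gn.
apply/two_satP; split; first exact: hS.
by apply/num_sat_gt0; rewrite lt0n.
Qed.

(** * Renaming variables *)

Definition rename_clause (V W : Type) (f : V -> W) (C : seq (bool * V)) : seq (bool * W) :=
  [seq (l.1, f l.2) | l <- C].

Definition rename (V W : Type) (f : V -> W) (F : formula V) : formula W :=
  map (rename_clause f) F.

Section Renaming.
Variables (V : finType) (W : eqType) (f : V -> W) (f_inj : injective f).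
Implicit Types (F : formula V) (C : seq (bool * V)).

Lemma mem_rename b x C : ((b, f x) \in rename_clause f C) = ((b, x) \in C).
Proof.
apply: (@mem_map _ _ (fun l : bool * V => (l.1, f l.2)) _ C (b, x)).
by move=> [c y] [d z] /= [-> /f_inj ->].
Qed.

Lemma vars_rename F : vars (rename f F) = map f (vars F).
Proof. by rewrite /vars /rename -map_flatten -!map_comp. Qed.

Lemma fix_var_rename b x F : fix_var b (f x) (rename f F) = rename f (fix_var b x F).
Proof.
rewrite /fix_var /rename filter_map -!map_comp.
rewrite (eq_filter (a2 := fun C => (b, x) \notin C)) => [|C]; last by rewrite /= mem_rename.
apply: eq_map => C /=; rewrite /rename_clause filter_map; congr map.
by apply: eq_filter => l /=; rewrite (inj_eq f_inj).
Qed.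

Lemma split_var_rename x (Fs : seq (formula V)) :
  split_var (f x) (map (rename f) Fs) = map (rename f) (split_var x Fs).
Proof. by elim: Fs => //= F Fs; rewrite /split_var /= => ->; rewrite !fix_var_rename. Qed.

Lemma branchings_rename c F :
  branchings c (rename f F) = map (map (rename f)) (branchings c F).
Proof.
elim: c => //= c ->; rewrite map_cat vars_rename; congr cat.
rewrite allpairs_mapl allpairs_mapr map_allpairs.
by apply: eq_allpairs => x Fs; rewrite split_var_rename.
Qed.

Lemma models_rename (a : W -> bool) F : models a (rename f F) = models (a \o f) F.
Proof. by rewrite /models all_map; apply: eq_all => C /=; rewrite has_map. Qed.

(** Argued through satisfiability rather than through the elimination steps. The transported
    assignment is false outside the image of [f]. *)
Lemma two_sat_rename F : two_sat (rename f F) = two_sat F.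
Proof.
have wF : width_le 2 (rename f F) = width_le 2 F.
  by rewrite /width_le all_map; apply: eq_all => C /=; rewrite size_map.
apply/idP/idP => /two_satP[w [a aF]]; apply/two_satP; rewrite ?wF in w *; split=> //.
  by exists (a \o f); rewrite -models_rename.
exists (fun w => [exists v, (f v == w) && a v]); rewrite models_rename.
move: aF; congr is_true; apply: eq_all => C; apply: eq_has => l /=; congr (_ == _).
apply/idP/existsP => [al|[v /andP[/eqP/f_inj -> //]]].
by exists l.2; rewrite eqxx.
Qed.

(** Links the test on ordinals, where models are counted, to the test on bit strings, which the
    machine performs. *)
Lemma majority_test_rename c F : majority_test c (rename f F) = majority_test c F.
Proof.
rewrite /majority_test branchings_rename has_map; apply: eq_has => Fs.
rewrite /= /balance_test !filter_map !size_map.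
have n_rename : @nilp _ \o rename f =1 @nilp _ by case.
rewrite (eq_filter n_rename) (eq_filter (a2 := fun F => ~~ nilp F)) => [|[]] //.
rewrite has_map (@eq_has _ (@two_sat W \o rename f) (@two_sat V)) // => G.
exact: two_sat_rename.
Qed.

Lemma tautology_rename C : tautology (rename_clause f C) = tautology C.
Proof.
by rewrite /tautology has_map; apply: eq_has => l /=; rewrite mem_rename.
Qed.

End Renaming.

Lemma tautology_sat n (a : assignment n) (C : clause n) : tautology C -> clause_sat a C.
Proof.
case/hasP=> l lC nlC; apply/hasP; rewrite /lit_sat.
case: (a l.2 =P l.1) => [al|/eqP al]; first by exists l; rewrite // al.
by exists (~~ l.1, l.2) => //=; move: al; case: (a l.2) l.1 => -[].
Qed.

Lemma gt_majority_tautology_free n (F : cnf n) :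
  gt_majority [seq C <- F | ~~ tautology C] = gt_majority F.
Proof.
rewrite /gt_majority !num_satE; congr (_ < 2 * _); apply: eq_bigr => a _; congr nat_of_bool.
rewrite /cnf_sat all_filter; apply: eq_all => C /=.
by case: (boolP (tautology C)) => //= tC; rewrite tautology_sat.
Qed.

(** * Stack machines *)

Record store (X : Type) := Store {
  st_input : seq X; st_main : seq X; st_a : seq X; st_b : seq X; st_c : seq X
}.

Notation rI := (@Ordinal 5 0 isT).
Notation rM := (@Ordinal 5 1 isT).
Notation rA := (@Ordinal 5 2 isT).
Notation rB := (@Ordinal 5 3 isT).
Notation rC := (@Ordinal 5 4 isT).

Definition get (X : Type) (s : store X) (i : 'I_5) : seq X :=
  match val i with
  | 0 => st_input s | 1 => st_main s | 2 => st_a s | 3 => st_b s | _ => st_c s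
  end.

Definition set (X : Type) (s : store X) (i : 'I_5) (l : seq X) : store X :=
  let: Store w m a b c := s in
  match val i with
  | 0 => Store l m a b c | 1 => Store w l a b c | 2 => Store w m l b c
  | 3 => Store w m a l c | _ => Store w m a b l
  end.

Lemma get_set (X : Type) (s : store X) i j l :
  get (set s i l) j = if j == i then l else get s j.
Proof.
by case: s => *; case: i j => -[|[|[|[|[|]]]]] // ? [] [|[|[|[|[|]]]]].
Qed.

Definition total_size (X : Type) (s : store X) : nat :=
  size (st_input s) + size (st_main s) + size (st_a s) + size (st_b s) + size (st_c s).

Lemma total_size_set (X : Type) (s : store X) i l :
  total_size (set s i l) + size (get s i) = total_size s + size l.
Proof.
by case: s => *; case: i => -[|[|[|[|[|//]]]]] ?; rewrite /total_size /get /set /=; lia.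
Qed.

Section Commands.
Variable X : finType.

(* [Push i j f] pushes on stack [i] the image by [f] of the top of stack [j]. *)
Inductive cmd :=
| Skip
| Push (i j : 'I_5) (f : option X -> X)
| Pop (i : 'I_5)
| Seq (c d : cmd)
| If (i : 'I_5) (p : option X -> bool) (c d : cmd)
| While (i : 'I_5) (p : option X -> bool) (c : cmd).

Inductive exec : cmd -> store X -> nat -> store X -> Prop :=
| exec_Skip s : exec Skip s 1 s
| exec_Push i j f s : exec (Push i j f) s 2 (set s i (f (ohead (get s j)) :: get s i))
| exec_Pop i s : exec (Pop i) s 1 (set s i (behead (get s i)))
| exec_Seq c d s t s' t' s'' : exec c s t s' -> exec d s' t' s'' -> exec (Seq c d) s (t + t') s''
| exec_If i (p : option X -> bool) c d s t s' :
    exec (if p (ohead (get s i)) then c else d) s t s' -> exec (If i p c d) s t.+1 s'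
| exec_While0 i (p : option X -> bool) c s : ~~ p (ohead (get s i)) -> exec (While i p c) s 1 s
| exec_While i (p : option X -> bool) c s t s' t' s'' : p (ohead (get s i)) ->
    exec c s t s' -> exec (While i p c) s' t' s'' -> exec (While i p c) s (t + t').+1 s''.

(** No command adds more symbols than it takes steps, so a time bound also bounds the size of the
    result. *)
Lemma exec_size c s t s' : exec c s t s' -> total_size s' <= total_size s + t.
Proof.
elim=> {c s t s'} [s|i j f s|i s|c d s t s' t' s'' _ ? _ ?|//|//|
  i p c s t s' t' s'' _ _ ? _ ?]; rewrite ?addn1; try lia.
- have := total_size_set s i (f (ohead (get s j)) :: get s i); rewrite /=; lia.
- have := total_size_set s i (behead (get s i)); rewrite size_behead; lia.
Qed.

(** The control positions of a command. Within [Push], [Some x] remembers the symbol to be written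
    after the head has moved left; within [If] and [While], [None] is the test. *)
Fixpoint point (c : cmd) : finType :=
  match c with
  | Skip | Pop _ => unit
  | Push _ _ _ => option X
  | Seq c d => (point c + point d)%type
  | If _ _ c d => option (point c + point d)
  | While _ _ c => option (point c)
  end.

Fixpoint entry (c : cmd) : point c :=
  match c with
  | Skip | Pop _ => tt
  | Push _ _ _ => None
  | Seq c d => inl (entry c)
  | If _ _ c d => None
  | While _ _ c => None
  end.

Definition reads : Type := {ffun 'I_5 -> option X}.
Definition action : Type := {ffun 'I_5 -> option X * move}.

Definition idle (r : reads) : action := [ffun i => (r i, Stay)].
Definition act_on (i : 'I_5) (o : option X) (m : move) (r : reads) : action :=
  [ffun j => if j == i then (o, m) else (r j, Stay)].

Fixpoint next (c : cmd) : point c -> reads -> option (point c) * action :=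
  match c with
  | Skip => fun _ r => (None, idle r)
  | Pop i => fun _ r => (None, act_on i None MoveR r)
  | Push i j f => fun q r =>
    if q is Some x then (None, act_on i (Some x) Stay r)
    else (Some (Some (f (r j))), act_on i (r i) MoveL r)
  | Seq c d => fun q r =>
    match q with
    | inl q => let: (q', a) := next q r in
               (Some (if q' is Some q' then inl q' else inr (entry d)), a)
    | inr q => let: (q', a) := next q r in (omap inr q', a)
    end
  | If i p c d => fun q r =>
    match q with
    | None => (Some (Some (if p (r i) then inl (entry c) else inr (entry d))), idle r)
    | Some (inl q) => let: (q', a) := next q r in (omap (Some \o inl) q', a)
    | Some (inr q) => let: (q', a) := next q r in (omap (Some \o inr) q', a)
    end
  | While i p c => fun q r =>
    match q with
    | None => (if p (r i) then Some (Some (entry c)) else None, idle r)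
    | Some q => let: (q', a) := next q r in (Some q', a)
    end
  end.

(** Popping leaves explicit blanks on the left, and writing back a blank that was read creates them
    on the right; tapes are therefore compared up to such cells. *)
Definition represents (t : tape X) (l : seq X) : Prop :=
  all (fun o => o == None) (leftward t) /\ exists k, rightward t = map Some l ++ nseq k None.

Definition tapes : Type := 'I_5 -> tape X.
Definition read_all (tp : tapes) : reads := [ffun i => tape_read (tp i)].
Definition act_all (a : action) (tp : tapes) : tapes :=
  fun i => tape_move (a i).2 (tape_write (a i).1 (tp i)).
Definition represents_all (tp : tapes) (s : store X) : Prop :=
  forall i, represents (tp i) (get s i).

Lemma represents_read t l : represents t l -> tape_read t = ohead l.
Proof. by case=> _ [k]; rewrite /tape_read => ->; case: l => //; case: k. Qed.

Lemma represents_idle t l : represents t l ->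
  represents (tape_move Stay (tape_write (tape_read t) t)) l.
Proof.
case: t => lt rt [/= l0 [k rk]]; split=> //=; rewrite /tape_read /= rk.
by case: l {rk} => [|x l] /=; [exists k.-1.+1; case: k | exists k].
Qed.

Lemma represents_pop t l : represents t l ->
  represents (tape_move MoveR (tape_write None t)) (behead l).
Proof.
case: t => lt rt [/= l0 [k rk]]; split=> //=; rewrite rk.
by case: l {rk} => [|x l] /=; [exists k.-1; case: k | exists k].
Qed.

Lemma represents_push t l x : represents t l ->
  represents (tape_move Stay (tape_write (Some x)
                (tape_move MoveL (tape_write (tape_read t) t)))) (x :: l).
Proof.
case: t => lt rt [/= l0 [k rk]]; split=> /=; first by case: lt l0 => //= o lt /andP[].
rewrite /tape_read /= rk.
by case: l {rk} => [|y l] /=; [exists k.-1.+1; case: k | exists k].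
Qed.

Lemma represents_all_idle tp s : represents_all tp s ->
  represents_all (act_all (idle (read_all tp)) tp) s.
Proof. by move=> R i; rewrite /act_all !ffunE /=; apply: represents_idle. Qed.

Lemma act_all_on i o m tp k :
  act_all (act_on i o m (read_all tp)) tp k =
  if k == i then tape_move m (tape_write o (tp k))
  else tape_move Stay (tape_write (tape_read (tp k)) (tp k)).
Proof. by rewrite /act_all !ffunE; case: eqP. Qed.

(** The step function [F] is abstract so that the induction can run a subcommand inside any larger
    control: [inside] embeds its positions, and [outside] is where control continues after its
    end. *)
Lemma exec_simulation c s t s' : exec c s t s' ->
  forall (C : Type) (F : C -> C) (inside : point c -> tapes -> C) (outside : tapes -> C),
  (forall q tp, F (inside q tp) =
     let: (q', a) := next q (read_all tp) in
     (if q' is Some q'' then inside q'' else outside) (act_all a tp)) ->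
  forall tp, represents_all tp s ->
  exists2 tp', represents_all tp' s' & iter t F (inside (entry c) tp) = outside tp'.
Proof.
elim=> {c s t s'} [s|i j f s|i s|c d s t s' t' s'' _ IHc _ IHd|i p c d s t s' _ IH|
    i p c s ps|i p c s t s' t' s'' ps _ IHc _ IHw] C F inside outside FE tp R.
- exists (act_all (idle (read_all tp)) tp); last by rewrite /= FE.
  exact: represents_all_idle.
- rewrite /= FE /= FE /=; eexists; last reflexivity.
  move=> k; rewrite get_set !act_all_on !ffunE (represents_read (R j)).
  case: (k =P i) => [->|_]; first exact: represents_push.
  by do 2!apply: represents_idle.
- rewrite /= FE /=; eexists; last reflexivity.
  move=> k; rewrite get_set !act_all_on.
  by case: (k =P i) => [->|_]; [apply: represents_pop | apply: represents_idle].
- have [|tp' R' e'] := IHc C F (inside \o inl) (inside (inr (entry d))) _ tp R.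
    by move=> q tp0 /=; rewrite FE /=; case: next => -[].
  have [|tp'' R'' e''] := IHd C F (inside \o inr) outside _ tp' R'.
    by move=> q tp0 /=; rewrite FE /=; case: next => -[].
  by exists tp'' => //; rewrite addnC iterD [X in iter _ _ X]e'.
- rewrite iterSr FE /= ffunE (represents_read (R i)).
  have {}R := represents_all_idle R.
  case: ifP IH => _ IH.
    apply: (IH C F (inside \o Some \o inl) outside _ _ R) => q tp0 /=.
    by rewrite FE /=; case: next => -[].
  apply: (IH C F (inside \o Some \o inr) outside _ _ R) => q tp0 /=.
  by rewrite FE /=; case: next => -[].
- rewrite /= FE /= ffunE (represents_read (R i)) (negPf ps); eexists; last reflexivity.
  exact: represents_all_idle.
- rewrite iterSr FE /= ffunE (represents_read (R i)) ps.
  have {}R := represents_all_idle R.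
  have [|tp' R' e'] := IHc C F (inside \o Some) (inside None) _ _ R.
    by move=> q tp0 /=; rewrite FE /=; case: next => -[].
  have [|tp'' R'' e''] := IHw C F inside outside _ _ R'; first exact: FE.
  by exists tp'' => //; rewrite addnC iterD [X in iter _ _ X]e'.
Qed.

End Commands.

Arguments Skip {X}.
Arguments Pop {X} i.

Section Machine.
Variables (Sigma : finType) (c : cmd (Sigma + bool)%type).

(** When the command has ended, in state [inl None], one further step turns the top of the main
    stack into the verdict; hence the strict bound [t < T] in [machine_answers]. *)
Definition machine : TM Sigma :=
  @MkTM Sigma 4 (option (point c) + bool)%type bool (inl (Some (entry c)))
    (fun q => if q is inr b then Some b else None)
    (fun q r => match q with
                | inl (Some p) => let: (p', a) := next p r in (inl p', a)
                | inl None => (inr (r rM == Some (inr true)), idle r)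
                | inr b => (inr b, idle r)
                end).

Lemma machine_answers (w : seq Sigma) t s' T :
  exec c (Store (map inl w) [::] [::] [::] [::]) t s' -> t < T ->
  @answers_within Sigma machine T w (ohead (st_main s') == Some (inr true)).
Proof.
move=> E tT; rewrite /answers_within -(subnK tT) iterD.
have fix_halted k (d : config machine) : tm_verdict (cfg_state d) ->
    iter k (@tm_step Sigma machine) d = d.
  move=> hd; elim: k => // k IH; rewrite iterS IH /tm_step.
  by case: (tm_verdict _) hd.
have [||tp' R' e'] := exec_simulation E (C := config machine) (F := @tm_step _ machine)
  (inside := fun p tp => @Config _ machine (inl (Some p)) tp)
  (outside := fun tp => @Config _ machine (inl None) tp) _ (tp := cfg_tapes (tm_init machine w)) _.
- by move=> q tp; rewrite /tm_step /=; case: next => -[].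
- move=> i; rewrite /tm_init /=; case: ifP => [/eqP ->|i0].
    by split=> //=; exists 0; rewrite cats0 -map_comp.
  by split=> //=; exists 0; case: i i0 => -[|[|[|[|[|]]]]].
have e1 : iter t.+1 (@tm_step _ machine) (tm_init machine w) =
    @Config _ machine (inr (ohead (st_main s') == Some (inr true))) (act_all (idle (read_all tp')) tp').
  by rewrite iterS [X in tm_step X]e' /tm_step /= ffunE (represents_read (R' rM)).
by rewrite [X in iter _ _ X]e1 fix_halted.
Qed.
End Machine.

(** * Trees on a stack *)

Inductive tree := Leaf | Node (l r : tree).

(* Polish notation: a prefix code, so that trees can be piled up on a stack
   without separators. *)
Fixpoint polish (t : tree) : seq bool :=
  if t is Node l r then true :: polish l ++ polish r else [:: false].

Lemma polish_cat_inj t u v w : polish t ++ v = polish u ++ w -> t = u /\ v = w.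
Proof.
elim: t u v w => [|t1 IH1 t2 IH2] [|u1 u2] v w //=; first by case.
by rewrite -!catA => -[/IH1[-> /IH2[-> ->]]].
Qed.

Lemma polish_inj : injective polish.
Proof. by move=> t u e; have [] := @polish_cat_inj t u [::] [::]; rewrite ?cats0. Qed.

Section Routines.
Variable Sigma : finType.
Notation X := (Sigma + bool)%type.

Definition runs (c : cmd X) (s : store X) (t : nat) (s' : store X) : Prop :=
  exists2 u, u <= t & exec c s u s'.

Lemma runs_leq c s t u s' : t <= u -> runs c s t s' -> runs c s u s'.
Proof. by move=> tu [v vt e]; exists v => //; apply: leq_trans tu. Qed.

Lemma runs_Seq c d s t s' u s'' : runs c s t s' -> runs d s' u s'' ->
  runs (Seq c d) s (t + u) s''.
Proof.
by move=> [v vt e] [w wu e']; exists (v + w); [apply: leq_add | apply: exec_Seq e e'].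
Qed.

Lemma runs_If i (p : option X -> bool) c d s t s' :
  runs (if p (ohead (get s i)) then c else d) s t s' -> runs (If i p c d) s t.+1 s'.
Proof. by move=> [v vt e]; exists v.+1 => //; apply: exec_If. Qed.

Lemma runs_While0 i (p : option X -> bool) c s :
  ~~ p (ohead (get s i)) -> runs (While i p c) s 1 s.
Proof. by move=> h; exists 1 => //; apply: exec_While0. Qed.

Lemma runs_While i (p : option X -> bool) c s t s' u s'' : p (ohead (get s i)) ->
  runs c s t s' -> runs (While i p c) s' u s'' -> runs (While i p c) s (t + u).+1 s''.
Proof.
move=> h [v vt e] [w wu e']; exists (v + w).+1; first by rewrite ltnS leq_add.
exact: exec_While h e e'.
Qed.

Lemma runs_Push i j f s : runs (Push i j f) s 2 (set s i (f (ohead (get s j)) :: get s i)).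
Proof. by exists 2 => //; apply: exec_Push. Qed.

Lemma runs_Pop i s : runs (Pop i) s 1 (set s i (behead (get s i))).
Proof. by exists 1 => //; apply: exec_Pop. Qed.

Definition bits (l : seq bool) : seq X := map inr l.
Definition top_is (b : bool) (o : option X) : bool := o == Some (inr b).
Definition put (b : bool) (i : 'I_5) : cmd X := Push i i (fun=> inr b).
Definition copy_top (i j : 'I_5) : cmd X := Push i j (odflt (inr false)).

Definition pour (i j : 'I_5) : cmd X :=
  While i isSome (Seq (copy_top j i) (Pop i)).

Lemma runs_pour_AM w m a b c :
  runs (pour rA rM) (Store w m a b c) (4 * size a).+1 (Store w (catrev a m) [::] b c).
Proof.
elim: a m => [|x a IH] m; first exact: runs_While0.
eapply runs_leq; last first.
  eapply runs_While; [by [] | | exact: IH].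
  by eapply runs_Seq; [apply: runs_Push | apply: runs_Pop].
by rewrite /= mulnS.
Qed.

Lemma runs_pour_BM w m a b c :
  runs (pour rB rM) (Store w m a b c) (4 * size b).+1 (Store w (catrev b m) a [::] c).
Proof.
elim: b m => [|x b IH] m; first exact: runs_While0.
eapply runs_leq; last first.
  eapply runs_While; [by [] | | exact: IH].
  by eapply runs_Seq; [apply: runs_Push | apply: runs_Pop].
by rewrite /= mulnS.
Qed.

Lemma runs_pour_BA w m a b c :
  runs (pour rB rA) (Store w m a b c) (4 * size b).+1 (Store w m (catrev b a) [::] c).
Proof.
elim: b a => [|x b IH] a; first exact: runs_While0.
eapply runs_leq; last first.
  eapply runs_While; [by [] | | exact: IH].
  by eapply runs_Seq; [apply: runs_Push | apply: runs_Pop].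
by rewrite /= mulnS.
Qed.

(* Moves the first tree of the main stack, reversed, to stack [i]. Stack C counts
   in unary the subtrees that remain to be read. *)
Definition fetch (i : 'I_5) : cmd X :=
  Seq (put true rC)
    (While rC isSome
      (Seq (copy_top i rM) (Seq (If rM (top_is true) (put true rC) (Pop rC)) (Pop rM)))).

Lemma runs_fetch_A t w m a b c : c = [::] ->
  runs (fetch rA) (Store w (bits (polish t) ++ m) a b c) (7 * size (polish t) + 3)
    (Store w m (catrev (bits (polish t)) a) b c).
Proof.
move=> ->; rewrite /fetch; set body := Seq (copy_top _ _) _.
have step x m' a' c' : runs body (Store w (inr x :: m') a' b (inr true :: c')) 6
    (Store w m' (inr x :: a') b (if x then [:: inr true, inr true & c'] else c')).
  case: x; eapply runs_leq; try (eapply runs_Seq; [exact: runs_Push | eapply runs_Seq;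
    [eapply runs_If; rewrite /=; first [exact: runs_Push | exact: runs_Pop] | exact: runs_Pop]]); done.
(* Stated for a subtree followed by an arbitrary rest of the run: reading [u] uses up exactly one
   unit of the counter, which makes the induction on trees possible. *)
suff loop u m' a' c' n s : runs (While rC isSome body) (Store w m' (catrev (bits (polish u)) a') b c') n s ->
    runs (While rC isSome body) (Store w (bits (polish u) ++ m') a' b (inr true :: c'))
      (7 * size (polish u) + n) s.
  apply: (runs_leq (t := 2 + (7 * size (polish t) + 1))); first by lia.
  apply: runs_Seq; first exact: runs_Push.
  by apply: loop; apply: runs_While0.
elim: u m' a' c' n s => [|u IHu v IHv] m' a' c' n s h.
  by apply: (runs_While (t := 6)) h => //; apply: (step false).
rewrite /= size_cat /bits map_cat -catA -/(bits _).
apply: (runs_leq (t := (6 + (7 * size (polish u) + (7 * size (polish v) + n))).+1)); first by lia.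
apply: runs_While (step _ _ _ _) _ => //.
apply: IHu; apply: IHv; move: h.
by rewrite /= /bits map_cat catrev_catl.
Qed.

Lemma runs_fetch_B t w m a b c : c = [::] ->
  runs (fetch rB) (Store w (bits (polish t) ++ m) a b c) (7 * size (polish t) + 3)
    (Store w m a (catrev (bits (polish t)) b) c).
Proof.
move=> ->; rewrite /fetch; set body := Seq (copy_top _ _) _.
have step x m' b' c' : runs body (Store w (inr x :: m') a b' (inr true :: c')) 6
    (Store w m' a (inr x :: b') (if x then [:: inr true, inr true & c'] else c')).
  case: x; eapply runs_leq; try (eapply runs_Seq; [exact: runs_Push | eapply runs_Seq;
    [eapply runs_If; rewrite /=; first [exact: runs_Push | exact: runs_Pop] | exact: runs_Pop]]); done.
suff loop u m' b' c' n s : runs (While rC isSome body) (Store w m' a (catrev (bits (polish u)) b') c') n s ->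
    runs (While rC isSome body) (Store w (bits (polish u) ++ m') a b' (inr true :: c'))
      (7 * size (polish u) + n) s.
  apply: (runs_leq (t := 2 + (7 * size (polish t) + 1))); first by lia.
  apply: runs_Seq; first exact: runs_Push.
  by apply: loop; apply: runs_While0.
elim: u m' b' c' n s => [|u IHu v IHv] m' b' c' n s h.
  by apply: (runs_While (t := 6)) h => //; apply: (step false).
rewrite /= size_cat /bits map_cat -catA -/(bits _).
apply: (runs_leq (t := (6 + (7 * size (polish u) + (7 * size (polish v) + n))).+1)); first by lia.
apply: runs_While (step _ _ _ _) _ => //.
apply: IHu; apply: IHv; move: h.
by rewrite /= /bits map_cat catrev_catl.
Qed.

Definition main_store w m : store X := Store w m [::] [::] [::].

Definition drop_tree : cmd X := Seq (fetch rA) (While rA isSome (Pop rA)).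

Lemma runs_drop t w m :
  runs drop_tree (main_store w (bits (polish t) ++ m)) (9 * size (polish t) + 4) (main_store w m).
Proof.
have clear a : runs (While rA isSome (Pop rA)) (Store w m a [::] [::]) (2 * size a).+1 (main_store w m).
  elim: a => [|x a IH]; first exact: runs_While0.
  eapply runs_leq; last by eapply runs_While; [by [] | apply: runs_Pop | exact: IH].
  by rewrite /= mulnS.
apply: runs_leq (runs_Seq (runs_fetch_A _ _ _ _ _ _) (clear _)) => //.
by rewrite catrevE cats0 size_rev size_map; lia.
Qed.

Definition dup_tree : cmd X :=
  Seq (fetch rA) (Seq (While rA isSome (Seq (copy_top rM rA) (Seq (copy_top rB rA) (Pop rA))))
    (Seq (pour rB rA) (pour rA rM))).

Lemma runs_dup t w m :
  runs dup_tree (main_store w (bits (polish t) ++ m)) (21 * size (polish t) + 6)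
    (main_store w (bits (polish t) ++ bits (polish t) ++ m)).
Proof.
rewrite /dup_tree; set loop := While _ _ _.
have runs_loop a m' b : runs loop (Store w m' a b [::]) (6 * size a).+1
    (Store w (catrev a m') [::] (catrev a b) [::]).
  elim: a m' b => [|x a IH] m' b; first exact: runs_While0.
  eapply runs_leq; last first.
    eapply runs_While; [by [] | | exact: IH].
    by do 2!(eapply runs_Seq; first exact: runs_Push); apply: runs_Pop.
  by rewrite /= mulnS.
have := runs_Seq (runs_fetch_A t w m [::] [::] (erefl [::])) (runs_Seq (runs_loop _ _ _)
  (runs_Seq (runs_pour_BA _ _ _ _ _) (runs_pour_AM _ _ _ _ _))).
rewrite !catrevE !cats0 !revK !size_rev !size_map => h.
by apply: runs_leq h; lia.
Qed.

Definition swap_trees : cmd X :=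
  Seq (fetch rA) (Seq (fetch rB) (Seq (pour rA rM) (pour rB rM))).

Lemma runs_swap t u w m :
  runs swap_trees (main_store w (bits (polish t) ++ bits (polish u) ++ m))
    (11 * (size (polish t) + size (polish u)) + 8)
    (main_store w (bits (polish u) ++ bits (polish t) ++ m)).
Proof.
have := runs_Seq (runs_fetch_A t w (bits (polish u) ++ m) [::] [::] (erefl [::]))
  (runs_Seq (runs_fetch_B u w m _ _ (erefl [::]))
     (runs_Seq (runs_pour_AM _ _ _ _ _) (runs_pour_BM _ _ _ _ _))).
rewrite !catrevE !cats0 !size_rev !revK !size_map => h.
by apply: runs_leq h; lia.
Qed.

Definition put_bits (l : seq bool) : cmd X :=
  foldl (fun c b => Seq c (put b rM)) Skip (rev l).

Lemma runs_put_bits l w m a b c :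
  runs (put_bits l) (Store w m a b c) (2 * size l).+1 (Store w (bits l ++ m) a b c).
Proof.
rewrite /put_bits; elim: l => [|x l IH]; first by exists 1 => //; apply: exec_Skip.
rewrite rev_cons -cats1 foldl_cat /=.
apply: runs_leq (runs_Seq IH (runs_Push _ _ _ _)) => //.
by rewrite mulnS /=; lia.
Qed.

(** Stack C is the flag: it becomes nonempty when two symbols differ or one word outlasts the
    other. *)
Definition eq_trees : cmd X :=
  Seq (fetch rA) (Seq (fetch rB)
   (Seq (While rA isSome
          (Seq (If rA (top_is true) (If rB (top_is true) Skip (put true rC))
                                    (If rB (top_is false) Skip (put true rC)))
               (Seq (Pop rA) (Pop rB))))
   (Seq (While rB isSome (Seq (put true rC) (Pop rB)))
   (If rC isSome (Seq (While rC isSome (Pop rC)) (put_bits (polish Leaf)))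
                 (put_bits (polish (Node Leaf Leaf))))))).

Lemma runs_eq t u w m :
  runs eq_trees (main_store w (bits (polish t) ++ bits (polish u) ++ m))
    (20 * (size (polish t) + size (polish u)) + 30)
    (main_store w (bits (polish (if polish t == polish u then Node Leaf Leaf else Leaf)) ++ m)).
Proof.
set x := polish t; set y := polish u.
rewrite /eq_trees; set loop1 := While rA _ _; set loop2 := While rB _ _.
have runs_loop1 a b c : exists2 c', (c' == [::]) = (c == [::]) && (a == take (size a) b) /\
      size c' <= size c + size a &
    runs loop1 (Store w m (bits a) (bits b) c) (8 * size a).+1
               (Store w m [::] (bits (drop (size a) b)) c').
  elim: a b c => [|p a IH] b c.
    by exists c; [rewrite take0 eqxx andbT addn0 | rewrite drop0; apply: runs_While0].
  pose c1 := if b is q :: _ then if p == q then c else inr true :: c else inr true :: c.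
  have [c' [e' s'] r'] := IH (behead b) c1; exists c'.
    split.
      rewrite e' /c1; clear; case: b => [|q b] /=; first by rewrite andbF.
      by rewrite eqseq_cons; case: (p == q); rewrite //= andbF.
    by apply: (leq_trans s'); rewrite /c1; clear; case: b => [|q b]; [|case: ifP => _]; rewrite /=; lia.
  have -> : drop (size (p :: a)) b = drop (size a) (behead b) by clear; case: b.
  apply: runs_leq (runs_While (t := 6) _ _ r') => //=; first by rewrite mulnS; lia.
  apply: (@runs_Seq _ _ _ 4 (Store w m (bits (p :: a)) (bits b) c1) 2); last first.
    have -> : bits (behead b) = behead (bits b) by clear; case: b.
    exact: (@runs_Seq _ _ _ 1 _ 1 _ (runs_Pop _ _) (runs_Pop _ _)).
  apply: runs_If; rewrite /c1; clear; case: p; apply: runs_If; case: b => [|[] b] /=;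
    by [apply: runs_Push | apply: (runs_leq (t := 1)) => //; exists 1 => //; apply: exec_Skip].
have runs_loop2 b c : runs loop2 (Store w m [::] (bits b) c) (4 * size b).+1
    (Store w m [::] [::] (nseq (size b) (inr true) ++ c)).
  elim: b c => [|p b IH] c; first exact: runs_While0.
  eapply runs_leq; last first.
    eapply runs_While; [by [] | |].
      by eapply runs_Seq; [apply: runs_Push | apply: runs_Pop].
    have -> : nseq (size (p :: b)) (inr true : X) ++ c = nseq (size b) (inr true) ++ inr true :: c.
      by rewrite /=; elim: (size b) => //= k ->.
    exact: IH.
  by rewrite /= mulnS.
have clear c : runs (While rC isSome (Pop rC)) (Store w m [::] [::] c) (2 * size c).+1 (main_store w m).
  elim: c => [|z c IH]; first exact: runs_While0.
  eapply runs_leq; last by eapply runs_While; [by [] | apply: runs_Pop | exact: IH].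
  by rewrite /= mulnS.
have [c [ce cs] r1] := runs_loop1 (rev x) (rev y) [::].
set d := nseq (size (drop (size (rev x)) (rev y))) (inr true : X) ++ c.
have de : (d == [::]) = (x == y).
  rewrite -[x == y](inj_eq (can_inj (@revK _))) /d; case E: (drop _ _) => [|q l] /=.
    by rewrite ce /= -{2}(cat_take_drop (size (rev x)) (rev y)) E cats0.
  apply/esym/eqP => xy; move: E.
  by rewrite xy drop_size.
have final : runs (If rC isSome (Seq (While rC isSome (Pop rC)) (put_bits (polish Leaf)))
                 (put_bits (polish (Node Leaf Leaf)))) (Store w m [::] [::] d) (2 * size d + 10)
     (main_store w (bits (polish (if x == y then Node Leaf Leaf else Leaf)) ++ m)).
  rewrite -de; case: (d =P [::]) => [->|] /=.
    apply: (runs_leq (t := 8)) => //; apply: runs_If; exact: (runs_put_bits (polish (Node Leaf Leaf))).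
  case: d {de} => // z d _; rewrite addnS; apply: runs_If => /=.
  apply: (runs_leq (t := (2 * size (z :: d)).+1 + 3)); first by rewrite /=; lia.
  apply: runs_Seq; first exact: clear.
  exact: (runs_put_bits (polish Leaf)).
eapply runs_leq; last first.
  eapply runs_Seq; first exact: runs_fetch_A.
  eapply runs_Seq; first exact: runs_fetch_B.
  rewrite !catrevE !cats0 -!map_rev.
  eapply runs_Seq; first exact: r1.
  by eapply runs_Seq; [exact: runs_loop2 | exact: final].
rewrite -/x -/y.
have : size d <= size y + size x.
  by rewrite /d size_cat size_nseq size_drop; move: cs; rewrite !size_rev /=; lia.
by rewrite size_drop !size_rev; move: (size d) (size x) (size y) => p q r; lia.
Qed.

End Routines.

(** * Functions computable in polynomial time *)

HB.mixin Record hasTree T of Equality T := {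
  to_tree : T -> tree;
  to_tree_inj : injective to_tree
}.

#[short(type="codeType")]
HB.structure Definition Code := {T of hasTree T & Equality T}.

Definition bool_to_tree (b : bool) : tree := if b then Node Leaf Leaf else Leaf.
Lemma bool_to_tree_inj : injective bool_to_tree. Proof. by case=> -[]. Qed.
HB.instance Definition _ := hasTree.Build bool bool_to_tree_inj.

Definition prod_to_tree (A B : codeType) (x : A * B) : tree :=
  Node (to_tree x.1) (to_tree x.2).
Lemma prod_to_tree_inj (A B : codeType) : injective (@prod_to_tree A B).
Proof. by case=> a b [a' b'] [/to_tree_inj -> /to_tree_inj ->]. Qed.
HB.instance Definition _ (A B : codeType) :=
  hasTree.Build (A * B)%type (@prod_to_tree_inj A B).

Definition seq_to_tree (A : codeType) (s : seq A) : tree :=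
  foldr (fun x t => Node (to_tree x) t) Leaf s.
Lemma seq_to_tree_inj (A : codeType) : injective (@seq_to_tree A).
Proof. by elim=> [|x s IH] [|y u] //= [/to_tree_inj -> /IH ->]. Qed.
HB.instance Definition _ (A : codeType) := hasTree.Build (seq A) (@seq_to_tree_inj A).

Definition tree_size (A : codeType) (x : A) : nat := size (polish (to_tree x)).

Lemma tree_size_pair (A B : codeType) (a : A) (b : B) :
  tree_size (a, b) = (tree_size a + tree_size b).+1.
Proof. by rewrite /tree_size /= size_cat. Qed.

Lemma tree_size_nil (A : codeType) : tree_size ([::] : seq A) = 1.
Proof. by []. Qed.

Lemma tree_size_cons (A : codeType) (x : A) (s : seq A) :
  tree_size (x :: s) = (tree_size x + tree_size s).+1.
Proof. by rewrite /tree_size /= size_cat. Qed.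

Lemma tree_size_bool (b : bool) : tree_size b <= 3.
Proof. by case: b. Qed.

Lemma tree_size_cat (A : codeType) (s u : seq A) :
  tree_size (s ++ u) <= tree_size s + tree_size u.
Proof.
elim: s => [|x s IH]; first by rewrite leq_addl.
by rewrite cat_cons !tree_size_cons addSn ltnS -addnA leq_add2l.
Qed.

Lemma tree_size_drop (A : codeType) k (s : seq A) : tree_size (drop k s) <= tree_size s.
Proof.
elim: s k => // x s IH [|k] //=; rewrite tree_size_cons.
by have := IH k; lia.
Qed.

Lemma tree_size_mem (A : codeType) (x : A) (s : seq A) : x \in s -> tree_size x <= tree_size s.
Proof.
elim: s => // y s IH; rewrite inE tree_size_cons => /orP[/eqP ->|/IH]; lia.
Qed.

Lemma size_le_tree_size (A : codeType) (s : seq A) : size s <= tree_size s.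
Proof. by elim: s => // x s IH; rewrite tree_size_cons /=; lia. Qed.

Lemma tree_size_seq_le (A : codeType) (s : seq A) k :
  (forall x, x \in s -> tree_size x <= k) -> tree_size s <= (size s * k.+1).+1.
Proof.
elim: s => //= x s IH H; rewrite tree_size_cons mulSn.
have := H x (mem_head _ _); have := IH (fun y ys => H y (mem_behead (s := x :: s) ys)); lia.
Qed.

(** The base is at least 2, so that constants and constant factors are absorbed by the exponent. *)
Definition poly_bounded (A : codeType) (T : A -> nat) : Prop :=
  exists c, forall x, T x <= (tree_size x).+2 ^ c.

Section PolynomialBounds.
Variable A : codeType.
Implicit Types T U : A -> nat.

Lemma poly_bounded_le T U : (forall x, T x <= U x) -> poly_bounded U -> poly_bounded T.
Proof. by move=> TU [c Uc]; exists c => x; apply: leq_trans (Uc x). Qed.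

Lemma poly_bounded_const k : poly_bounded (fun _ : A => k).
Proof.
exists k => x; case: k => // k.
by apply: leq_trans (ltnW (ltn_expl k.+1 (ltnSn 1))) _; rewrite leq_exp2r.
Qed.

Lemma poly_bounded_tree_size : poly_bounded (@tree_size A).
Proof. by exists 1 => x; rewrite expn1; lia. Qed.

Lemma poly_bounded_mul T U : poly_bounded T -> poly_bounded U -> poly_bounded (fun x => T x * U x).
Proof. by move=> [c Tc] [d Ud]; exists (c + d) => x; rewrite expnD leq_mul. Qed.

Lemma poly_bounded_add T U : poly_bounded T -> poly_bounded U -> poly_bounded (fun x => T x + U x).
Proof.
move=> [c Tc] [d Ud]; exists (c + d).+1 => x; rewrite expnS.
apply: (@leq_trans (2 * (tree_size x).+2 ^ (c + d))); last by rewrite leq_mul2r; lia.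
by rewrite mul2n -addnn leq_add // ?(leq_trans (Tc x)) ?(leq_trans (Ud x)) // leq_exp2l //; lia.
Qed.

Lemma poly_bounded_exp T c : poly_bounded T -> poly_bounded (fun x => T x ^ c).
Proof.
move=> [d Td]; exists (d * c) => x; rewrite expnM.
by case: c => // c; rewrite leq_exp2r.
Qed.

Lemma poly_bounded_comp (B : codeType) (f : A -> B) (V : B -> nat) :
  poly_bounded (fun x => tree_size (f x)) -> poly_bounded V -> poly_bounded (fun x => V (f x)).
Proof.
move=> pf [c Vc]; apply: (poly_bounded_le (U := fun x => (tree_size (f x) + 2) ^ c)).
  by move=> x; rewrite addn2.
by apply: poly_bounded_exp; apply: poly_bounded_add => //; apply: poly_bounded_const.
Qed.

End PolynomialBounds.

(** * Closure of polynomial time under basic constructions *)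

Section PolynomialTime.
Variable Sigma : finType.
Notation X := (Sigma + bool)%type.

Definition code (A : codeType) (x : A) : seq X := bits Sigma (polish (to_tree x)).

Definition computes (A B : codeType) (p : cmd X) (f : A -> B) (T : A -> nat) : Prop :=
  forall x w m, runs p (main_store w (code x ++ m)) (T x) (main_store w (code (f x) ++ m)).

Definition poly_time (A B : codeType) (f : A -> B) : Prop :=
  exists p T, poly_bounded T /\ computes p f T.

Lemma poly_time_size (A B : codeType) (f : A -> B) :
  poly_time f -> poly_bounded (fun x => tree_size (f x)).
Proof.
move=> [p [T [pT pf]]]; apply: (poly_bounded_le (U := fun x => tree_size x + T x)).
  move=> x; have [u uT /exec_size] := pf x [::] [::].
  by rewrite /total_size /= !cats0 !size_map -/(tree_size _) -/(tree_size _); lia.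
by apply: poly_bounded_add => //; apply: poly_bounded_tree_size.
Qed.

Lemma poly_time_ext (A B : codeType) (f g : A -> B) : f =1 g -> poly_time f -> poly_time g.
Proof. by move=> fg [p [T [pT pf]]]; exists p, T; split=> // x w m; rewrite -fg. Qed.

(** A change of type that leaves the tree alone costs nothing; for instance, a nonempty list has the
    same tree as the pair of its head and its tail. *)
Lemma poly_time_recode (A B : codeType) (f : A -> B) :
  (forall x, to_tree (f x) = to_tree x) -> poly_time f.
Proof.
move=> e; exists Skip, (fun=> 1); split; first exact: poly_bounded_const.
by move=> x w m; rewrite /code e; exists 1 => //; apply: exec_Skip.
Qed.

Lemma poly_time_id (A : codeType) : poly_time (fun x : A => x).
Proof. exact: poly_time_recode. Qed.

Lemma poly_time_comp (A B C : codeType) (g : B -> C) (f : A -> B) :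
  poly_time g -> poly_time f -> poly_time (fun x => g (f x)).
Proof.
move=> [p [T [pT pg]]] pf; have sf := poly_time_size pf.
case: pf => [q [U [pU pf]]]; exists (Seq q p), (fun x => U x + T (f x)); split.
  by apply: poly_bounded_add => //; apply: poly_bounded_comp.
by move=> x w m; apply: runs_Seq (pf _ _ _) (pg _ _ _).
Qed.

Lemma poly_time_const (A B : codeType) (b : B) : poly_time (fun _ : A => b).
Proof.
exists (Seq (drop_tree Sigma) (put_bits Sigma (polish (to_tree b)))).
exists (fun x => (9 * tree_size x + 4) + (2 * tree_size b).+1); split; last first.
  by move=> x w m; eapply runs_Seq; [exact: runs_drop | exact: runs_put_bits].
apply: poly_bounded_add; last exact: poly_bounded_const.
apply: poly_bounded_add; last exact: poly_bounded_const.
apply: poly_bounded_mul; [exact: poly_bounded_const | exact: poly_bounded_tree_size].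
Qed.

Lemma poly_bounded_linear (A : codeType) (T : A -> nat) a b :
  poly_bounded T -> poly_bounded (fun x => a * T x + b).
Proof.
move=> pT; apply: poly_bounded_add; last exact: poly_bounded_const.
by apply: poly_bounded_mul => //; apply: poly_bounded_const.
Qed.

Lemma poly_time_pair (A B C : codeType) (f : A -> B) (g : A -> C) :
  poly_time f -> poly_time g -> poly_time (fun x => (f x, g x)).
Proof.
move=> [p [T [pT pf]]] pg; have sg := poly_time_size pg; case: pg => [q [U [pU pg]]].
(* [q] consumes the upper copy of the argument, the swap exposes the other copy to [p], and the
   pushed [true] joins both results to a pair. *)
exists (Seq (dup_tree Sigma) (Seq q (Seq (swap_trees Sigma) (Seq p (put Sigma true rM))))).
exists (fun x => 21 * tree_size x + 6 +
  (U x + (11 * (tree_size (g x) + tree_size x) + 8 + (T x + 2)))); split.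
  have pA := @poly_bounded_tree_size A.
  apply: poly_bounded_add; first exact: poly_bounded_linear.
  apply: poly_bounded_add => //; apply: poly_bounded_add.
    by apply: poly_bounded_linear; apply: poly_bounded_add.
  by apply: poly_bounded_add => //; apply: poly_bounded_const.
move=> x w m; rewrite /code.
eapply runs_Seq; first exact: runs_dup.
eapply runs_Seq; first exact: pg.
eapply runs_Seq; first exact: runs_swap.
eapply runs_Seq; first exact: pf.
rewrite /= /bits map_cat -catA; exact: runs_Push.
Qed.

Definition fst_tree : cmd X := Seq (Pop rM) (Seq (swap_trees Sigma) (drop_tree Sigma)).
Definition snd_tree : cmd X := Seq (Pop rM) (drop_tree Sigma).

Lemma runs_fst_tree l r w m :
  runs fst_tree (main_store w (bits Sigma (polish (Node l r)) ++ m))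
    (20 * size (polish (Node l r)) + 20) (main_store w (bits Sigma (polish l) ++ m)).
Proof.
eapply runs_leq; last first.
  eapply runs_Seq; first exact: runs_Pop.
  rewrite /= /bits map_cat -catA.
  by eapply runs_Seq; [exact: runs_swap | exact: runs_drop].
by rewrite /= size_cat; lia.
Qed.

Lemma runs_snd_tree l r w m :
  runs snd_tree (main_store w (bits Sigma (polish (Node l r)) ++ m))
    (20 * size (polish (Node l r)) + 20) (main_store w (bits Sigma (polish r) ++ m)).
Proof.
eapply runs_leq; last first.
  eapply runs_Seq; first exact: runs_Pop.
  rewrite /= /bits map_cat -catA; exact: runs_drop.
by rewrite /= size_cat; lia.
Qed.

Lemma poly_time_fst (G A B : codeType) (f : G -> A * B) :
  poly_time f -> poly_time (fun x => (f x).1).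
Proof.
apply: poly_time_comp; exists fst_tree, (fun x => 20 * tree_size x + 20); split.
  exact/poly_bounded_linear/poly_bounded_tree_size.
by move=> [a b] w m; apply: runs_fst_tree.
Qed.

Lemma poly_time_snd (G A B : codeType) (f : G -> A * B) :
  poly_time f -> poly_time (fun x => (f x).2).
Proof.
apply: poly_time_comp; exists snd_tree, (fun x => 20 * tree_size x + 20); split.
  exact/poly_bounded_linear/poly_bounded_tree_size.
by move=> [a b] w m; apply: runs_snd_tree.
Qed.

Lemma poly_time_if (A B : codeType) (b : A -> bool) (f g : A -> B) :
  poly_time b -> poly_time f -> poly_time g -> poly_time (fun x => if b x then f x else g x).
Proof.
move=> [p [T [pT pb]]] [q [U [pU pf]]] [r [V [pV pg]]].
exists (Seq (dup_tree Sigma) (Seq p (If rM (top_is true)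
  (Seq (drop_tree Sigma) q) (Seq (drop_tree Sigma) r)))).
exists (fun x => 21 * tree_size x + 6 + (T x + (32 + (U x + V x)))); split.
  apply: poly_bounded_add; first exact/poly_bounded_linear/poly_bounded_tree_size.
  apply: poly_bounded_add => //; apply: poly_bounded_add; first exact: poly_bounded_const.
  exact: poly_bounded_add.
move=> x w m; eapply runs_Seq; first exact: runs_dup.
eapply runs_Seq; first exact: pb.
apply: (runs_leq (t := (31 + (U x + V x)).+1)) => //; apply: runs_If.
rewrite /code; case: (b x) => /=.
  apply: (runs_leq (t := 31 + U x)); first by lia.
  eapply runs_Seq; [exact: (runs_drop (Node Leaf Leaf)) | exact: pf].
apply: (runs_leq (t := 13 + V x)); first by lia.
eapply runs_Seq; [exact: (runs_drop Leaf) | exact: pg].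
Qed.

Lemma poly_time_nilp (G A : codeType) (f : G -> seq A) :
  poly_time f -> poly_time (fun x => nilp (f x)).
Proof.
apply: poly_time_comp.
exists (If rM (top_is true) (Seq (drop_tree Sigma) (put_bits Sigma (polish Leaf)))
   (Seq (drop_tree Sigma) (put_bits Sigma (polish (Node Leaf Leaf))))).
exists (fun x => 9 * tree_size x + 12); split.
  exact/poly_bounded_linear/poly_bounded_tree_size.
move=> [|a s] w m.
  apply: (runs_leq (t := (13 + 7).+1)) => //; apply: runs_If => /=.
  by eapply runs_Seq; [exact: (runs_drop Leaf) | exact: (runs_put_bits (polish (Node Leaf Leaf)))].
apply: (runs_leq (t := (9 * tree_size (a :: s) + 4 + 3).+1)); first by lia.
apply: runs_If => /=.
eapply runs_Seq; [exact: (runs_drop (to_tree (a :: s))) | exact: (runs_put_bits (polish Leaf))].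
Qed.

Lemma poly_time_behead (G A : codeType) (f : G -> seq A) :
  poly_time f -> poly_time (fun x => behead (f x)).
Proof.
apply: poly_time_comp.
exists (If rM (top_is true) snd_tree Skip), (fun x => 20 * tree_size x + 21); split.
  exact/poly_bounded_linear/poly_bounded_tree_size.
move=> [|a s] w m; rewrite addnS; apply: runs_If => /=.
  by exists 1 => //; apply: exec_Skip.
exact: (runs_snd_tree (to_tree a) (to_tree s)).
Qed.

Lemma poly_time_head (G A : codeType) (a0 : A) (f : G -> seq A) :
  poly_time f -> poly_time (fun x => head a0 (f x)).
Proof.
apply: poly_time_comp; have [p [T [pT pa]]] := @poly_time_const (seq A) A a0.
exists (If rM (top_is true) fst_tree p), (fun x => (20 * tree_size x + 20 + T x) + 1); split.
  apply: poly_bounded_add; last exact: poly_bounded_const.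
  by apply: poly_bounded_add => //; exact/poly_bounded_linear/poly_bounded_tree_size.
move=> s w m; rewrite addn1; apply: runs_If.
case: s => [|a s] /=; first by apply: runs_leq (pa [::] w m); rewrite leq_addl.
by apply: runs_leq (runs_fst_tree (to_tree a) (to_tree s) w m); rewrite leq_addr.
Qed.

Lemma poly_time_cons (G A : codeType) (f : G -> A) (g : G -> seq A) :
  poly_time f -> poly_time g -> poly_time (fun x => f x :: g x).
Proof.
move=> pf pg; apply: (poly_time_comp (g := fun p : A * seq A => p.1 :: p.2) (f := fun x => (f x, g x))).
  by apply: poly_time_recode => -[].
exact: poly_time_pair.
Qed.

Lemma poly_time_eq (G A : codeType) (f g : G -> A) :
  poly_time f -> poly_time g -> poly_time (fun x => f x == g x).
Proof.
move=> pf pg.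
apply: (poly_time_comp (g := fun p : A * A => p.1 == p.2) (f := fun x => (f x, g x))); last first.
  exact: poly_time_pair.
exists (Seq (Pop rM) (eq_trees Sigma)), (fun x => 20 * tree_size x + 31); split.
  exact/poly_bounded_linear/poly_bounded_tree_size.
move=> [a b] w m; eapply runs_leq; last first.
  eapply runs_Seq; first exact: runs_Pop.
  rewrite /= /bits map_cat -catA.
  have -> : code (a == b) = bits Sigma (polish (if polish (to_tree a) == polish (to_tree b)
      then Node Leaf Leaf else Leaf)).
    case: (polish _ =P polish _) => [/polish_inj/to_tree_inj ->|ne]; first by rewrite /= eqxx.
    by rewrite /=; case: (a =P b) => // ab; case: ne; rewrite ab.
  exact: runs_eq.
by rewrite tree_size_pair /tree_size; lia.
Qed.

Lemma poly_time_negb (G : codeType) (b : G -> bool) :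
  poly_time b -> poly_time (fun x => ~~ b x).
Proof.
move=> pb; apply: (poly_time_ext (f := fun x => if b x then false else true)).
  by move=> x; case: (b x).
by apply: poly_time_if => //; apply: poly_time_const.
Qed.

Lemma poly_time_andb (G : codeType) (b c : G -> bool) :
  poly_time b -> poly_time c -> poly_time (fun x => b x && c x).
Proof. by move=> pb pc; apply: poly_time_if => //; apply: poly_time_const. Qed.

Lemma poly_time_orb (G : codeType) (b c : G -> bool) :
  poly_time b -> poly_time c -> poly_time (fun x => b x || c x).
Proof. by move=> pb pc; apply: poly_time_if => //; apply: poly_time_const. Qed.

End PolynomialTime.

(** * Folds *)

Section Folds.
Variable Sigma : finType.
Notation poly_time f := (poly_time Sigma f).

Lemma code_pair (A B : codeType) (a : A) (b : B) m :
  code Sigma (a, b) ++ m = inr true :: code Sigma a ++ code Sigma b ++ m.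
Proof. by rewrite /code /= /bits map_cat -catA. Qed.

Lemma code_cons (A : codeType) (a : A) (s : seq A) m :
  code Sigma (a :: s) ++ m = inr true :: code Sigma a ++ code Sigma s ++ m.
Proof. exact: (code_pair a s). Qed.

(** Iterating a polynomial-time step can blow up the accumulator exponentially; hence the hypothesis
    on the size of all intermediate results. *)
Lemma poly_time_foldl (G A B : codeType) (h : G -> B -> A -> B) (b : G -> B) (s : G -> seq A) :
  poly_time (fun y : G * B * A => h y.1.1 y.1.2 y.2) -> poly_time b -> poly_time s ->
  (exists c, forall x k, tree_size (foldl (h x) (b x) (take k (s x))) <= (tree_size x).+2 ^ c) ->
  poly_time (fun x => foldl (h x) (b x) (s x)).
Proof.
move=> ph pb ps [c Hc].
pose step (y : A * seq A * (G * B)) := (y.1.2, (y.2.1, h y.2.1 y.2.2 y.1.1)).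
have pid := @poly_time_id Sigma (A * seq A * (G * B))%type.
have [q [T [[d Td] qstep]]] : poly_time step.
  apply: poly_time_pair; first exact/poly_time_snd/poly_time_fst.
  apply: poly_time_pair; first exact/poly_time_fst/poly_time_snd.
  apply: (poly_time_comp (g := fun y : G * B * A => h y.1.1 y.1.2 y.2)
    (f := fun y : A * seq A * (G * B) => (y.2.1, y.2.2, y.1.1))) => //.
  apply: poly_time_pair; last exact/poly_time_fst/poly_time_fst.
  by apply: poly_time_pair; [exact/poly_time_fst/poly_time_snd | exact/poly_time_snd/poly_time_snd].
have [p [U [pU pinit]]] : poly_time (fun x => (s x, (x, b x))).
  by apply: poly_time_pair => //; apply: poly_time_pair => //; apply: poly_time_id.
pose M x := (tree_size (s x) + tree_size x + (tree_size x).+2 ^ c + 4) ^ d.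
have pM : poly_bounded M.
  apply: poly_bounded_exp; apply: poly_bounded_add; last exact: poly_bounded_const.
  apply: poly_bounded_add; last by exists c.
  by apply: poly_bounded_add; [exact: poly_time_size ps | exact: poly_bounded_tree_size].
(* Between rounds the unread list lies above the pair of parameter and accumulator, and its top
   symbol tells whether it is empty. The pushed [true] joins both trees to one argument of [step];
   the [Pop] separates the result again. *)
pose body := Seq (put Sigma true rM) (Seq q (Pop rM)).
exists (Seq p (Seq (Pop rM) (Seq (While rM (top_is true) body) (Seq (Pop rM) (snd_tree Sigma))))).
exists (fun x => U x + (1 + ((tree_size (s x) * (M x + 4) + 1) +
    (1 + (20 * (tree_size x + (tree_size x).+2 ^ c).+1 + 20))))); split.
  apply: poly_bounded_add => //; apply: poly_bounded_add; first exact: poly_bounded_const.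
  apply: poly_bounded_add.
    apply: poly_bounded_add; last exact: poly_bounded_const.
    apply: poly_bounded_mul; first exact: poly_time_size ps.
    by apply: poly_bounded_add => //; apply: poly_bounded_const.
  apply: poly_bounded_add; first exact: poly_bounded_const.
  apply: poly_bounded_linear; apply: (poly_bounded_le (U := fun x => tree_size x + (tree_size x).+2 ^ c + 1)).
    by move=> x; rewrite addn1.
  apply: poly_bounded_add; last exact: poly_bounded_const.
  by apply: poly_bounded_add; [exact: poly_bounded_tree_size | exists c].
move=> x w m.
have loop u v : s x = u ++ v ->
    runs (While rM (top_is true) body)
      (main_store w (code Sigma v ++ code Sigma (x, foldl (h x) (b x) u) ++ m))
      (size v * (M x + 4) + 1)
      (main_store w (code Sigma ([::] : seq A) ++ code Sigma (x, foldl (h x) (b x) (s x)) ++ m)).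
  elim: v u => [|y v IH] u e; first by rewrite e cats0; apply: runs_While0.
  have {}IH := IH (rcons u y); rewrite foldl_rcons cat_rcons in IH.
  apply: (runs_leq (t := (2 + (M x + 1) + (size v * (M x + 4) + 1)).+1)).
    by rewrite [size (y :: v)]/= mulSn; move: (size v * _); move: (M x) => N S; lia.
  eapply runs_While; [by [] | | exact: IH].
  eapply runs_Seq; first exact: runs_Push.
  have Q := qstep (y, v, (x, foldl (h x) (b x) u)) w m.
  rewrite (code_pair (y, v)) (code_pair y v) (code_pair v) /= in Q.
  eapply runs_Seq; last first.
    have := @runs_Pop Sigma rM (main_store w
      (inr true :: code Sigma v ++ code Sigma (x, h x (foldl (h x) (b x) u) y) ++ m)).
    exact.
  rewrite code_cons; eapply runs_leq; last exact: Q.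
  apply: leq_trans (Td _) _; rewrite /M.
  have k_le : tree_size (foldl (h x) (b x) u) <= (tree_size x).+2 ^ c.
    by have := Hc x (size u); rewrite e take_size_cat.
  have v_le : tree_size (y :: v) <= tree_size (s x).
    by have := tree_size_drop (size u) (s x); rewrite e drop_size_cat.
  case: (d) => // d'; rewrite leq_exp2r // !tree_size_pair.
  by move: v_le k_le; rewrite tree_size_cons; lia.
have init : runs p (main_store w (code Sigma x ++ m)) (U x)
  (main_store w (code Sigma (s x, (x, b x)) ++ m)) := pinit x w m.
rewrite (code_pair (s x)) in init.
eapply runs_Seq; first exact: init.
eapply runs_Seq; first exact: runs_Pop.
eapply runs_Seq.
  eapply runs_leq; last exact: (loop [::] (s x) erefl).
  by rewrite leq_add2r leq_mul2r size_le_tree_size orbT.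
eapply runs_Seq; first exact: runs_Pop.
eapply runs_leq; last exact: (runs_snd_tree (to_tree x)).
rewrite leq_add2r leq_mul2l -/(polish _) /= size_cat ltnS leq_add //=.
by have := Hc x (size (s x)); rewrite take_size.
Qed.

(** If the growth per step is bounded independently of the accumulator, sizes add up over the list
    instead of compounding. *)
Lemma poly_time_foldl_additive (G A B : codeType) (h : G -> B -> A -> B)
    (b : G -> B) (s : G -> seq A) (D : G * A -> nat) :
  poly_time (fun y : G * B * A => h y.1.1 y.1.2 y.2) -> poly_time b -> poly_time s ->
  poly_bounded D -> (forall x y z, tree_size (h x y z) <= tree_size y + D (x, z)) ->
  poly_time (fun x => foldl (h x) (b x) (s x)).
Proof.
move=> ph pb ps [c Dc] hD; apply: poly_time_foldl => //.
suff [d Hd] : poly_bounded (fun x => tree_size (b x) +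
    tree_size (s x) * (tree_size x + tree_size (s x) + 3) ^ c).
  exists d => x k; apply: leq_trans (Hd x).
  apply: (@leq_trans (tree_size (b x) +
    size (take k (s x)) * (tree_size x + tree_size (s x) + 3) ^ c)); last first.
    rewrite leq_add2l leq_mul2r; apply/orP; right.
    by rewrite (leq_trans _ (size_le_tree_size _)) // size_take; case: ltnP => // /ltnW.
  have : forall y, y \in take k (s x) -> tree_size y <= tree_size (s x).
    by move=> y /mem_take/tree_size_mem.
  elim/last_ind: (take k (s x)) => [|u y IH] su; first by rewrite addn0.
  rewrite foldl_rcons size_rcons mulSn; apply: leq_trans (hD _ _ _) _.
  rewrite addnCA addnC; apply: leq_add.
    apply: leq_trans (Dc _) _; rewrite tree_size_pair.
    have := su y; rewrite mem_rcons mem_head => /(_ isT) yl.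
    by case: (c) => // c'; rewrite leq_exp2r //; lia.
  by apply: IH => z zu; apply: su; rewrite mem_rcons inE zu orbT.
have ss := poly_time_size ps; apply: poly_bounded_add; first exact: poly_time_size pb.
apply: poly_bounded_mul => //; apply: poly_bounded_exp.
apply: poly_bounded_add; last exact: poly_bounded_const.
by apply: poly_bounded_add => //; apply: poly_bounded_tree_size.
Qed.

Lemma poly_time_rev (G A : codeType) (s : G -> seq A) :
  poly_time s -> poly_time (fun x => rev (s x)).
Proof.
move=> ps; apply: (poly_time_ext (f := fun x => foldl (fun u y => y :: u) [::] (s x))).
  by move=> x; elim/last_ind: (s x) => // u y; rewrite foldl_rcons rev_rcons => ->.
apply: (poly_time_foldl_additive (D := fun p => tree_size p)) => //.
- apply: poly_time_cons; first exact/poly_time_snd/poly_time_id.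
  exact/poly_time_snd/poly_time_fst/poly_time_id.
- exact: poly_time_const.
- exact: poly_bounded_tree_size.
- by move=> x u y; rewrite tree_size_cons tree_size_pair; lia.
Qed.

End Folds.

(** * Lists *)

Section Lists.
Variable Sigma : finType.
Notation poly_time f := (poly_time Sigma f).

Lemma poly_time_app2 (G A B C : codeType) (h : A -> B -> C) (f : G -> A) (g : G -> B) :
  poly_time (fun y : A * B => h y.1 y.2) -> poly_time f -> poly_time g ->
  poly_time (fun x => h (f x) (g x)).
Proof.
move=> ph pf pg.
exact: (poly_time_comp (f := fun x => (f x, g x)) ph (poly_time_pair pf pg)).
Qed.

Lemma poly_time_cat (G A : codeType) (s t : G -> seq A) :
  poly_time s -> poly_time t -> poly_time (fun x => s x ++ t x).
Proof.
move=> ps pt; apply: (poly_time_ext (f := fun x => foldl (fun u y => y :: u) (t x) (rev (s x)))).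
  by move=> x; rewrite foldl_rev; elim: (s x) => //= y u ->.
apply: (poly_time_foldl_additive (D := fun p => tree_size p)) => //; last 1 first.
- by move=> x u y; rewrite tree_size_cons tree_size_pair; lia.
- apply: poly_time_cons; first exact/poly_time_snd/poly_time_id.
  exact/poly_time_snd/poly_time_fst/poly_time_id.
- exact: poly_time_rev.
- exact: poly_bounded_tree_size.
Qed.

Lemma poly_time_map (G A B : codeType) (h : G -> A -> B) (s : G -> seq A) :
  poly_time (fun y : G * A => h y.1 y.2) -> poly_time s ->
  poly_time (fun x => [seq h x y | y <- s x]).
Proof.
move=> ph ps; apply: (poly_time_ext (f := fun x => rev (foldl (fun u y => h x y :: u) [::] (s x)))).
  by move=> x; elim/last_ind: (s x) => // u y; rewrite foldl_rcons rev_cons map_rcons => ->.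
apply: poly_time_rev.
apply: (poly_time_foldl_additive (D := fun p => tree_size (h p.1 p.2) + 1)) => //.
- apply: poly_time_cons; last exact/poly_time_snd/poly_time_fst/poly_time_id.
  apply: (poly_time_app2 (h := h)) => //; last exact/poly_time_snd/poly_time_id.
  exact/poly_time_fst/poly_time_fst/poly_time_id.
- exact: poly_time_const.
- apply: poly_bounded_add; last exact: poly_bounded_const.
  exact: (poly_time_size ph).
- by move=> x u y; rewrite tree_size_cons /= addn1 addnS addnC.
Qed.

Lemma poly_time_filter (G A : codeType) (p : G -> A -> bool) (s : G -> seq A) :
  poly_time (fun y : G * A => p y.1 y.2) -> poly_time s ->
  poly_time (fun x => [seq y <- s x | p x y]).
Proof.
move=> pp ps; apply: (poly_time_ext
  (f := fun x => rev (foldl (fun u y => if p x y then y :: u else u) [::] (s x)))).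
  move=> x; elim/last_ind: (s x) => // u y; rewrite foldl_rcons filter_rcons.
  by case: ifP => _ <- //; rewrite rev_cons.
apply: poly_time_rev.
apply: (poly_time_foldl_additive (D := fun p => tree_size p)) => //.
- apply: poly_time_if; last exact/poly_time_snd/poly_time_fst/poly_time_id.
    apply: (poly_time_app2 (h := p)) => //; last exact/poly_time_snd/poly_time_id.
    exact/poly_time_fst/poly_time_fst/poly_time_id.
  apply: poly_time_cons; first exact/poly_time_snd/poly_time_id.
  exact/poly_time_snd/poly_time_fst/poly_time_id.
- exact: poly_time_const.
- exact: poly_bounded_tree_size.
- by move=> x u y; case: ifP; rewrite ?tree_size_cons tree_size_pair; lia.
Qed.

Lemma poly_time_has (G A : codeType) (p : G -> A -> bool) (s : G -> seq A) :
  poly_time (fun y : G * A => p y.1 y.2) -> poly_time s ->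
  poly_time (fun x => has (p x) (s x)).
Proof.
move=> pp ps; apply: (poly_time_ext (f := fun x => foldl (fun b y => b || p x y) false (s x))).
  move=> x; elim/last_ind: (s x) => // u y; rewrite foldl_rcons has_rcons => ->.
  by rewrite orbC.
apply: (poly_time_foldl_additive (D := fun p => 3)) => //.
- apply: poly_time_orb; first exact/poly_time_snd/poly_time_fst/poly_time_id.
  apply: (poly_time_app2 (h := p)) => //; last exact/poly_time_snd/poly_time_id.
  exact/poly_time_fst/poly_time_fst/poly_time_id.
- exact: poly_time_const.
- exact: poly_bounded_const.
- by move=> x u y; apply: leq_trans (tree_size_bool _) _; rewrite leq_addl.
Qed.

Lemma poly_time_all (G A : codeType) (p : G -> A -> bool) (s : G -> seq A) :
  poly_time (fun y : G * A => p y.1 y.2) -> poly_time s ->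
  poly_time (fun x => all (p x) (s x)).
Proof.
move=> pp ps; apply: (poly_time_ext (f := fun x => ~~ has (fun y => ~~ p x y) (s x))).
  by move=> x; rewrite has_predC negbK.
by apply: poly_time_negb; apply: poly_time_has => //; apply: poly_time_negb.
Qed.

Lemma poly_time_mem (G A : codeType) (f : G -> A) (s : G -> seq A) :
  poly_time f -> poly_time s -> poly_time (fun x => f x \in s x).
Proof.
move=> pf ps; apply: (poly_time_ext (f := fun x => has (fun y => y == f x) (s x))).
  by move=> x; rewrite has_pred1.
apply: poly_time_has => //; apply: poly_time_eq; first exact/poly_time_snd/poly_time_id.
by apply: (poly_time_comp (g := f)) => //; exact/poly_time_fst/poly_time_id.
Qed.

Lemma poly_time_flatten (G A : codeType) (s : G -> seq (seq A)) :
  poly_time s -> poly_time (fun x => flatten (s x)).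
Proof.
move=> ps; apply: (poly_time_ext (f := fun x => foldl (fun u y => u ++ y) [::] (s x))).
  by move=> x; elim/last_ind: (s x) => // u y; rewrite foldl_rcons flatten_rcons => ->.
apply: (poly_time_foldl_additive (D := fun p => tree_size p)) => //.
- apply: poly_time_cat; last exact/poly_time_snd/poly_time_id.
  exact/poly_time_snd/poly_time_fst/poly_time_id.
- exact: poly_time_const.
- exact: poly_bounded_tree_size.
- by move=> x u y; apply: leq_trans (tree_size_cat _ _) _; rewrite tree_size_pair; lia.
Qed.

Lemma poly_time_allpairs (G A B C : codeType) (h : G -> A -> B -> C)
    (s : G -> seq A) (t : G -> seq B) :
  poly_time (fun y : G * A * B => h y.1.1 y.1.2 y.2) -> poly_time s -> poly_time t ->
  poly_time (fun x => [seq h x y z | y <- s x, z <- t x]).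
Proof.
move=> ph ps pt; apply: poly_time_flatten; apply: poly_time_map => //.
apply: (poly_time_map (h := fun (p : G * A) z => h p.1 p.2 z)) => //.
by apply: (poly_time_comp (g := t)) => //; exact/poly_time_fst/poly_time_id.
Qed.

Lemma poly_time_undup (G A : codeType) (s : G -> seq A) :
  poly_time s -> poly_time (fun x => undup (s x)).
Proof.
move=> ps; apply: (poly_time_ext
  (f := fun x => foldl (fun u y => if y \in u then u else y :: u) [::] (rev (s x)))).
  by move=> x; rewrite foldl_rev; elim: (s x) => //= y u ->; rewrite mem_undup.
apply: (poly_time_foldl_additive (D := fun p => tree_size p)).
- have py : poly_time (fun y : G * seq A * A => y.2) by exact/poly_time_snd/poly_time_id.
  have pu : poly_time (fun y : G * seq A * A => y.1.2) by exact/poly_time_snd/poly_time_fst/poly_time_id.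
  by apply: poly_time_if => //; [apply: poly_time_mem | apply: poly_time_cons].
- exact: poly_time_const.
- exact: poly_time_rev.
- exact: poly_bounded_tree_size.
- by move=> x u y; case: ifP; rewrite ?tree_size_cons tree_size_pair; lia.
Qed.

(** Lengths are compared without arithmetic, by removing one entry of [t x] for each entry of
    [s x]. *)
Lemma poly_time_size_lt (G A B : codeType) (s : G -> seq A) (t : G -> seq B) :
  poly_time s -> poly_time t -> poly_time (fun x => size (s x) < size (t x)).
Proof.
move=> ps pt; apply: (poly_time_ext
  (f := fun x => ~~ nilp (foldl (fun u _ => behead u) (t x) (s x)))).
  move=> x; rewrite /nilp -lt0n -[RHS]subn_gt0; congr (_ < _).
  elim: (s x) (t x) => [|y u IH] v /=; first by rewrite subn0.
  by rewrite IH size_behead -subn1 -subnDA add1n.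
apply/poly_time_negb/poly_time_nilp.
apply: (poly_time_foldl_additive (D := fun p => 0)) => //.
- exact/poly_time_behead/poly_time_snd/poly_time_fst/poly_time_id.
- exact: poly_bounded_const.
- by move=> x u y; rewrite -drop1 addn0 tree_size_drop.
Qed.

Lemma poly_time_size_le (G A : codeType) (s : G -> seq A) k :
  poly_time s -> poly_time (fun x => size (s x) <= k).
Proof.
move=> ps; apply: (poly_time_ext (f := fun x => nilp (drop k (s x)))).
  by move=> x; rewrite /nilp size_drop subn_eq0.
apply: poly_time_nilp; elim: k => [|k IH].
  by apply: (poly_time_ext _ ps) => x; rewrite drop0.
apply: (poly_time_ext (f := fun x => behead (drop k (s x)))); last exact: poly_time_behead.
by move=> x; rewrite -drop1 drop_drop add1n.
Qed.

End Lists.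

Ltac poly_time_step :=
  simpl;
  lazymatch goal with
  | |- poly_time _ ?f =>
    lazymatch f with
    | fun x => x => eapply poly_time_id
    | fst => eapply (poly_time_fst (f := fun x => x))
    | snd => eapply (poly_time_snd (f := fun x => x))
    | fun _ => ?c => eapply poly_time_const
    | fun x => fst (@?g x) => eapply poly_time_fst
    | fun x => snd (@?g x) => eapply poly_time_snd
    | @rev _ => eapply (poly_time_rev (s := fun x => x))
    | filter ?p => eapply (poly_time_filter (p := fun _ => p) (s := fun x => x))
    | map ?h => eapply (poly_time_map (h := fun _ => h) (s := fun x => x))
    | has ?p => eapply (poly_time_has (p := fun _ => p) (s := fun x => x))
    | all ?p => eapply (poly_time_all (p := fun _ => p) (s := fun x => x))
    | fun x => (@?g x, @?h x) => eapply poly_time_pair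
    | fun x => @?g x && @?h x => eapply poly_time_andb
    | fun x => @?g x || @?h x => eapply poly_time_orb
    | fun x => ~~ @?g x => eapply poly_time_negb
    | fun x => @?g x == @?h x => eapply poly_time_eq
    | fun x => @?g x \in @?h x => eapply poly_time_mem
    | fun x => nilp (@?g x) => eapply poly_time_nilp
    | fun x => @?g x :: @?h x => eapply poly_time_cons
    | fun x => @?g x ++ @?h x => eapply poly_time_cat
    | fun x => rev (@?g x) => eapply poly_time_rev
    | fun x => behead (@?g x) => eapply poly_time_behead
    | fun x => head _ (@?g x) => eapply poly_time_head
    | fun x => has (@?g x) (@?h x) => eapply poly_time_has
    | fun x => all (@?g x) (@?h x) => eapply poly_time_all
    | fun x => undup (@?g x) => eapply poly_time_undup
    | fun x => allpairs (@?p x) (@?g x) (@?h x) => eapply poly_time_allpairs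
    | fun x => size (@?g x) < size (@?h x) => eapply poly_time_size_lt
    | fun x => size (@?g x) <= _ => eapply poly_time_size_le
    | fun x => flatten (@?g x) => eapply poly_time_flatten
    | fun x => map (@?g x) (@?h x) => eapply poly_time_map
    | fun x => filter (@?g x) (@?h x) => eapply poly_time_filter
    | _ => eapply poly_time_if
    end
  end.
Ltac poly_time_auto := repeat (first [assumption | poly_time_step]).

(** * The majority test in polynomial time *)

Section Algorithm.
Variables (Sigma : finType) (V : codeType).
Notation poly_time f := (poly_time Sigma f).

Lemma poly_time_vars (G : codeType) (F : G -> formula V) :
  poly_time F -> poly_time (fun y => vars (F y)).
Proof. by move=> pF; rewrite /vars; poly_time_auto. Qed.

Lemma poly_time_fix_var (G : codeType) b (x : G -> V) (F : G -> formula V) :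
  poly_time x -> poly_time F -> poly_time (fun y => fix_var b (x y) (F y)).
Proof.
move=> px pF.
apply: (poly_time_app2 (h := fun x F => fix_var b x F)) => //.
by rewrite /fix_var; poly_time_auto.
Qed.

Lemma poly_time_split_var (G : codeType) (x : G -> V) (Fs : G -> seq (formula V)) :
  poly_time x -> poly_time Fs -> poly_time (fun y => split_var (x y) (Fs y)).
Proof.
move=> px pFs; apply: (poly_time_app2 (h := fun x Fs => split_var x Fs)) => //.
rewrite /split_var; apply: poly_time_flatten; apply: poly_time_map; last exact/poly_time_snd/poly_time_id.
by poly_time_auto; apply: poly_time_fix_var; poly_time_auto.
Qed.

Lemma poly_time_branchings c : poly_time (@branchings V c).
Proof.
elim: c => [|c IH] /=; first by poly_time_auto.
apply: poly_time_cat => //; apply: poly_time_allpairs => //.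
  by apply: poly_time_split_var; poly_time_auto.
exact/poly_time_vars/poly_time_id.
Qed.

Lemma poly_time_tautology (G : codeType) (C : G -> seq (bool * V)) :
  poly_time C -> poly_time (fun y => tautology (C y)).
Proof.
apply: poly_time_comp; rewrite /tautology; poly_time_auto.
Qed.

Lemma poly_time_eliminate (G : codeType) (x : G -> V) (F : G -> formula V) :
  poly_time x -> poly_time F -> poly_time (fun y => eliminate (x y) (F y)).
Proof.
move=> px pF; apply: (poly_time_app2 (h := fun x F => eliminate x F)) => //.
rewrite /eliminate /drop_var; poly_time_auto.
Qed.

(** Only quadratically many clauses of at most two literals can be formed from the literals of [F].
    This is what keeps the elimination polynomial. *)
Lemma tree_size_binary_clauses (F H : formula V) :
  uniq H -> (forall C, C \in H -> size C <= 2 /\ {subset C <= flatten F}) ->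
  tree_size H <= ((1 + tree_size F + tree_size F * tree_size F) * (2 * tree_size F + 4)).+1.
Proof.
move=> uH HF; set L := flatten F in HF.
pose U := [::] :: [seq [:: l] | l <- L] ++ [seq [:: l; l'] | l <- L, l' <- L].
have sL : size L <= tree_size F.
  rewrite /L; elim: (F) => [|C F' IH] //=; rewrite size_cat tree_size_cons.
  by apply: leqW; apply: leq_add (size_le_tree_size C) IH.
have sH : size H <= 1 + size L + size L * size L.
  apply: leq_trans (_ : size U <= _); last by rewrite /= size_cat size_map size_allpairs -addnA add1n.
  apply: uniq_leq_size => // -[|l [|l' [|? ?]]] /HF[//= _ sC]; rewrite inE ?eqxx //= mem_cat.
    by apply/orP; left; apply/mapP; exists l => //; apply: sC; rewrite mem_head.
  apply/orP; right; apply/allpairsP; exists (l, l'); split=> //=.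
    by apply: sC; rewrite mem_head.
  by apply: sC; rewrite !inE eqxx orbT.
(* A clause consists of at most two literals of size at most [tree_size F], two list nodes and a
   leaf. *)
apply: leq_trans (tree_size_seq_le (k := 2 * tree_size F + 3) _) _; last first.
  rewrite ltnS -addnS; apply: leq_mul => //; apply: leq_trans sH _.
  by apply: leq_add; [rewrite leq_add2l | apply: leq_mul].
move=> C /HF[sC CL]; apply: leq_trans (tree_size_seq_le (k := tree_size F) _) _.
  move=> l /CL/flattenP[D DF lD]; exact: leq_trans (tree_size_mem lD) (tree_size_mem DF).
apply: leq_trans (_ : (2 * (tree_size F).+1).+1 <= _).
  by rewrite ltnS leq_mul2r sC orbT.
by lia.
Qed.

Lemma eliminate_binary_clauses x (L : seq (bool * V)) (H : formula V) :
  (forall C, C \in H -> size C <= 2 /\ {subset C <= L}) ->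
  forall C, C \in eliminate x H -> size C <= 2 /\ {subset C <= L}.
Proof.
move=> HL C; rewrite /eliminate mem_undup mem_cat => /orP[|].
  by rewrite mem_filter => /andP[_ /HL].
(* A clause of at most two literals keeps at most one when [x] is dropped, so a resolvent again has
   at most two. *)
have drop1 b D : (b, x) \in D -> D \in H -> size (drop_var x D) <= 1 /\ {subset drop_var x D <= L}.
  move=> xD /HL[sD DL]; split; last by move=> l; rewrite mem_filter => /andP[_ /DL].
  have := count_predC (fun l : bool * V => l.2 != x) D; rewrite -size_filter -/(drop_var x D).
  have : 0 < count (predC (fun l : bool * V => l.2 != x)) D.
    by rewrite -has_count; apply/hasP; exists (b, x) => //=; rewrite eqxx.
  move=> p0 e; move: sD; rewrite -e; move: p0; case: count => // p _.
  by rewrite addnS ltnS; apply: leq_trans; rewrite leq_addr.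
case/allpairsP=> -[D E] /= [+ + ->]; rewrite !mem_filter.
move=> /andP[/andP[xD _] DH] /andP[/andP[xE _] EH].
have [sD DL] := drop1 _ _ xD DH; have [sE EL] := drop1 _ _ xE EH.
split; first by rewrite size_cat (leq_add sD sE).
by move=> l; rewrite mem_cat => /orP[/DL|/EL].
Qed.

Lemma poly_time_two_sat (G : codeType) (F : G -> formula V) :
  poly_time F -> poly_time (fun y => two_sat (F y)).
Proof.
apply: poly_time_comp; rewrite /two_sat /width_le; apply: poly_time_andb.
  by poly_time_auto.
apply: poly_time_negb; apply: poly_time_mem; first exact: poly_time_const.
apply: poly_time_foldl.
- by apply: poly_time_eliminate; poly_time_auto.
- by poly_time_auto.
- exact: (poly_time_vars (F := fun H => H) (poly_time_id _ _)).
have [c Hc] : poly_bounded (fun F : formula V =>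
    (1 + tree_size F + tree_size F * tree_size F) * (2 * tree_size F + 4) + 1).
  have pF := @poly_bounded_tree_size (formula V).
  apply: poly_bounded_add; last exact: poly_bounded_const.
  apply: poly_bounded_mul; last exact: poly_bounded_linear.
  apply: poly_bounded_add; last exact: poly_bounded_mul.
  by apply: poly_bounded_add => //; apply: poly_bounded_const.
exists c => H k; apply: leq_trans (Hc H); rewrite addn1 /=.
pose inv K := uniq K /\ forall C, C \in K -> size C <= 2 /\ {subset C <= flatten H}.
suff [uK HK] : inv (foldl (fun K x => eliminate x K) (undup [seq C <- H | size C <= 2])
    (take k (vars H))) by apply: tree_size_binary_clauses.
elim/last_ind: (take k (vars H)) => [|S x [_ IH]].
  split; first exact: undup_uniq.
  move=> C; rewrite mem_undup mem_filter => /andP[sC CH]; split=> // l lC.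
  by apply/flattenP; exists C.
rewrite foldl_rcons; split; first exact: undup_uniq.
exact: eliminate_binary_clauses IH.
Qed.

Lemma poly_time_majority_test c : poly_time (@majority_test V c).
Proof.
rewrite /majority_test; apply: poly_time_has; last exact: poly_time_branchings.
rewrite /balance_test.
have p2 (G A : codeType) : poly_time (fun y : G * A => y.2).
  exact/poly_time_snd/poly_time_id.
have pg : poly_time (fun y : formula V * seq (formula V) => [seq F <- y.2 | nilp F]).
  by apply: (poly_time_filter (p := fun _ F => nilp F)) => //; apply: poly_time_nilp.
have pb : poly_time (fun y : formula V * seq (formula V) => [seq F <- y.2 | ~~ nilp F]).
  apply: (poly_time_filter (p := fun _ F => ~~ nilp F)) => //.
  exact/poly_time_negb/poly_time_nilp.
apply: (poly_time_ext (f := fun y : formula V * seq (formula V) =>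
  let good := [seq F <- y.2 | nilp F] in let bad := [seq F <- y.2 | ~~ nilp F] in
  if size bad < size good then true else
  if size good < size bad then false else has (@two_sat V) bad)).
  by move=> y /=; case: ltngtP.
apply: poly_time_if; [exact: poly_time_size_lt | exact: poly_time_const |].
apply: poly_time_if; [exact: poly_time_size_lt | exact: poly_time_const |].
apply: poly_time_has => //; exact: poly_time_two_sat.
Qed.

End Algorithm.

(** * Parsing formulas *)

(** Flags turn case analysis on symbols into tests of booleans. The tree of a symbol is that of its
    triple, so the conversion is free. *)
Definition bits_of_symbol (s : cnf_symbol) : bool * bool * bool :=
  match s with
  | Digit b => (true, false, b)
  | Sign b => (false, true, b)
  | EndClause => (false, false, false)
  end.

Definition symbol_to_tree (s : cnf_symbol) : tree := to_tree (bits_of_symbol s).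
Lemma symbol_to_tree_inj : injective symbol_to_tree.
Proof. by move=> s u /to_tree_inj; case: s => [b|b|]; case: u => [c|c|] //= [->]. Qed.
HB.instance Definition _ := hasTree.Build cnf_symbol symbol_to_tree_inj.

Notation name_formula := (seq (seq (bool * seq bool))).

(* Strings are read from right to left: the first component holds the digits
   still to be attached, the head of the second the clause being read. *)
Definition parse_step (s : cnf_symbol) (st : seq bool * name_formula) : seq bool * name_formula :=
  match s with
  | Digit b => (b :: st.1, st.2)
  | Sign b => ([::], ((b, st.1) :: head [::] st.2) :: behead st.2)
  | EndClause => (st.1, [::] :: st.2)
  end.

Definition parse (w : seq cnf_symbol) : seq bool * name_formula :=
  foldr parse_step ([::], [::]) w.

Definition unparse (st : seq bool * name_formula) : seq cnf_symbol :=
  map Digit st.1 ++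
  flatten [seq flatten [seq Sign l.1 :: map Digit l.2 | l <- C] ++ [:: EndClause] | C <- st.2].

Lemma parse_digits ds w : parse (map Digit ds ++ w) = (ds ++ (parse w).1, (parse w).2).
Proof. by elim: ds => [|d ds IH] /=; [case: parse | rewrite IH]. Qed.

Lemma parse_unparse st : parse (unparse st) = st.
Proof.
case: st => ds F; rewrite /unparse /= parse_digits.
suff -> : parse (flatten [seq flatten [seq Sign l.1 :: map Digit l.2 | l <- C] ++ [:: EndClause]
    | C <- F]) = ([::], F) by rewrite cats0.
elim: F => [|C F IH] //=; rewrite -catA.
suff H D w G : parse w = ([::], D :: G) ->
    parse (flatten [seq Sign l.1 :: map Digit l.2 | l <- C] ++ w) = ([::], (C ++ D) :: G).
  by rewrite (H [::] _ F) ?cats0 //= -/(parse _) IH.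
move=> pw; elim: C => [|[b x] C IHC] //=.
by rewrite -catA -/(parse _) parse_digits IHC /= cats0.
Qed.

(** * Binary numerals as names of variables *)

Definition canonical (ds : seq bool) : bool := (ds == [:: false]) || head false (rev ds).

Definition value (ds : seq bool) : nat := foldr (fun (b : bool) v => b + v.*2) 0 ds.

(** Digits come least significant first, so the last disagreement decides, in favour of [x < n]
    exactly if the digit of [n] is 1. Missing digits of [x] count as 0; leftover digits make the
    answer false. *)
Definition less (x n : seq bool) : bool :=
  let st := foldl (fun (st : seq bool * bool) d =>
                     (behead st.1, if head false st.1 == d then st.2 else d)) (x, false) n in
  (st.1 == [::]) && st.2.

Lemma foldl_less x n b : 
  foldl (fun (st : seq bool * bool) d =>
           (behead st.1, if head false st.1 == d then st.2 else d)) (x, b) n =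
  (drop (size n) x,
   (value (take (size n) x) < value n) || (value (take (size n) x) == value n) && b).
Proof.
elim: n x b => [|d n IH] x b /=; first by rewrite drop0 take0.
rewrite IH; case: x => [|h x] /=.
  by congr (_, _); case: d; case: b => /=; lia.
by congr (_, _); case: d; case: h; case: b => /=; lia.
Qed.

Lemma lessE x n : less x n = (size x <= size n) && (value x < value n).
Proof.
rewrite /less foldl_less /= andbF orbF -size_eq0 size_drop subn_eq0.
by case: (leqP (size x) (size n)) => //= xn; rewrite take_oversize.
Qed.

Lemma value_binary m : value (binary m) = m.
Proof.
rewrite -[RHS]binaryK /binary; move: (trunc_log 2 m).+1 => r.
have value_mkseq (f : nat -> bool) : value (mkseq f r) = \sum_(i < r) f i * 2 ^ i.
  elim: r f => [|r IH] f; first by rewrite big_ord0.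
  rewrite /mkseq /= (iotaDl 1 0) -map_comp (IH (f \o S)) big_ord_recl muln1.
  congr (_ + _); rewrite -muln2 big_distrl /=; apply: eq_bigr => i _.
  by rewrite -mulnA -expnSr.
exact: (value_mkseq (fun i => odd (m %/ 2 ^ i))).
Qed.

Lemma value_lt ds : value ds < 2 ^ size ds.
Proof. by elim: ds => // -[] ds IH; rewrite /= expnS; lia. Qed.

Lemma value_rcons ds (b : bool) : value (rcons ds b) = value ds + b * 2 ^ size ds.
Proof. by elim: ds => [|d ds IH] /=; [rewrite addn0 muln1 | rewrite IH expnS; lia]. Qed.

Lemma odd_value ds i : odd (value ds %/ 2 ^ i) = nth false ds i.
Proof.
elim: ds i => [|d ds IH] [|i] //=; rewrite ?div0n //.
  by rewrite divn1 oddD odd_double addbF oddb.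
rewrite expnS divnMA -IH divn2 halfD odd_double andbF add0n doubleK.
by case: d.
Qed.

Lemma canonical_binary m : canonical (binary m).
Proof.
case: m => // m; rewrite /canonical; apply/orP; right.
rewrite /binary mkseqS rev_rcons /=.
have /andP[l u] := trunc_log_bounds (isT : 1 < 2) (isT : 0 < m.+1).
set t := trunc_log _ _ in l u *; have := divn_eq m.+1 (2 ^ t).
have : m.+1 %/ 2 ^ t < 2 by rewrite ltn_divLR ?expn_gt0 // -expnS.
have : 0 < m.+1 %/ 2 ^ t by rewrite divn_gt0 ?expn_gt0.
by case: (_ %/ _) => [|[]].
Qed.

Lemma binary_value ds : canonical ds -> binary (value ds) = ds.
Proof.
case/orP=> [/eqP -> //|]; case/lastP: ds => // ds b; rewrite rev_rcons /= => bT.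
have e : trunc_log 2 (value (rcons ds b)) = size ds.
  apply: trunc_log_eq => //; rewrite -[(size ds).+1](size_rcons ds b) value_lt andbT.
  by rewrite value_rcons bT mul1n leq_addl.
apply: (@eq_from_nth _ false); rewrite /binary e ?size_mkseq ?size_rcons // => i il.
by rewrite nth_mkseq // odd_value.
Qed.

Definition width_int (k : int) (V : Type) (F : formula V) : bool :=
  match k with Posz m => width_le m F | Negz _ => nilp F end.

Definition valid_names (n : seq bool) (F : name_formula) : bool :=
  canonical n && all (all (fun l => canonical l.2 && less l.2 n)) F.

(** [parse] returns something on every string; comparing [unparse] of the result with [w] takes over
    the syntax check. *)
Definition accept (k : int) (c : nat) (w : seq cnf_symbol) : bool :=
  let st := parse w in
  [&& unparse st == w, valid_names st.1 st.2, width_int k st.2 &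
      majority_test c [seq C <- st.2 | ~~ tautology C]].

Definition name (n : nat) (i : 'I_n) : seq bool := binary i.

Lemma name_inj n : injective (@name n).
Proof. by move=> i j /binary_inj/val_inj. Qed.

Lemma encode_cnf_unparse n (F : cnf n) :
  encode_cnf F = unparse (binary n, rename (@name n) F).
Proof.
rewrite /encode_cnf /unparse; congr cat; congr flatten.
rewrite /rename -map_comp; apply: eq_map => C /=.
by rewrite /encode_clause -cats1 /rename_clause -map_comp.
Qed.

Lemma valid_names_rename n (F : cnf n) : valid_names (binary n) (rename (@name n) F).
Proof.
rewrite /valid_names canonical_binary /=; apply/allP => _ /mapP[C _ ->].
apply/allP => _ /mapP[l _ ->] /=; rewrite canonical_binary lessE !value_binary ltn_ord andbT.
by rewrite !size_mkseq ltnS leq_trunc_log // ltnW.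
Qed.

Lemma valid_namesP (ds : seq bool) (F : name_formula) : valid_names ds F ->
  exists n (G : cnf n), ds = binary n /\ F = rename (@name n) G.
Proof.
case/andP=> cds vF; exists (value ds).
suff [G ->] : exists G : cnf (value ds), F = rename (@name _) G.
  by exists G; rewrite binary_value.
elim: F vF => [|C F IH] /=; first by exists [::].
case/andP=> vC /IH[G ->].
suff [D ->] : exists D : clause (value ds), C = rename_clause (@name _) D by exists (D :: G).
elim: C vC => [|[b x] C IHC] /=; first by exists [::].
case/andP=> /andP[cx]; rewrite lessE => /andP[_ xlt] /IHC[D ->].
by exists ((b, Ordinal xlt) :: D); rewrite /= /name /= binary_value.
Qed.

Lemma width_int_rename k n (F : cnf n) : width_int k (rename (@name n) F) = is_kCNF k F.
Proof.
rewrite /is_kCNF; case: k => m /=.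
  by rewrite /width_le all_map; apply: eq_all => C /=; rewrite size_map.
by case: F => [|C F] //=.
Qed.

(** A single [c] serves all [k <= 3], because a k-CNF then has width at most 3. *)
Lemma acceptP : {c | forall k w, (k <= 3)%R -> accept k c w <-> GtMajoritySAT k w}.
Proof.
have [c cP] := majority_testP; exists c => k w k3.
have test n (F : cnf n) : is_kCNF k F ->
    majority_test c [seq C <- rename (@name n) F | ~~ tautology C] = gt_majority F.
  move=> kF; have -> : [seq C <- rename (@name n) F | ~~ tautology C] =
      rename (@name n) [seq C <- F | ~~ tautology C].
    rewrite /rename filter_map; congr map; apply: eq_filter => C /=.
    by rewrite (tautology_rename (@name_inj n)).
  rewrite (majority_test_rename (@name_inj n)) cP ?gt_majority_tautology_free //.
    apply/allP => C; rewrite mem_filter => /andP[_ /(allP kF) Ck].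
    exact: (Order.POrderTheory.le_trans Ck k3).
  by apply/allP => C; rewrite mem_filter => /andP[].
split=> [/and4P[/eqP uw vst wk maj]|[n [F [-> kF gF]]]].
  have [n [F [e1 e2]]] := valid_namesP vst.
  have kF : is_kCNF k F by rewrite -width_int_rename -e2.
  exists n, F; split=> //; last by rewrite -test // -e2.
  by rewrite encode_cnf_unparse -e1 -e2 -surjective_pairing uw.
rewrite /accept encode_cnf_unparse parse_unparse eqxx valid_names_rename /=.
by rewrite width_int_rename kF test.
Qed.

Section Acceptance.
Variable Sigma : finType.
Notation poly_time f := (poly_time Sigma f).

Lemma poly_time_bits_of_symbol (G : codeType) (s : G -> cnf_symbol) :
  poly_time s -> poly_time (fun x => bits_of_symbol (s x)).
Proof. by apply: poly_time_comp; apply: poly_time_recode. Qed.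

Lemma poly_time_of_bool (G A : codeType) (f : bool -> A) (b : G -> bool) :
  poly_time b -> poly_time (fun x => f (b x)).
Proof.
move=> pb; apply: (poly_time_ext (f := fun x => if b x then f true else f false)).
  by move=> x; case: (b x).
by apply: poly_time_if => //; apply: poly_time_const.
Qed.

Lemma poly_time_parse : poly_time parse.
Proof.
rewrite /parse.
apply: (poly_time_ext (f := fun w => foldl (fun st s => parse_step s st) ([::], [::]) (rev w))).
  by move=> w; rewrite foldl_rev.
have D_poly : poly_bounded (fun p : seq cnf_symbol * cnf_symbol => 20).
  exact: poly_bounded_const.
apply: (poly_time_foldl_additive (G := seq cnf_symbol) (h := fun _ st s => parse_step s st) _ _ _ D_poly).
- apply: (poly_time_ext (f := fun y : seq cnf_symbol * (seq bool * name_formula) * cnf_symbol =>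
    let p := bits_of_symbol y.2 in let st := y.1.2 in
    if p.1.1 then (p.2 :: st.1, st.2) else
    if p.1.2 then ([::], ((p.2, st.1) :: head [::] st.2) :: behead st.2)
    else (st.1, [::] :: st.2))).
    by move=> [[w st] []].
  have pp : poly_time (fun y : seq cnf_symbol * (seq bool * name_formula) * cnf_symbol =>
    bits_of_symbol y.2).
    by apply: poly_time_bits_of_symbol; poly_time_auto.
  have p1 := poly_time_fst (poly_time_fst pp).
  have p2 := poly_time_snd (poly_time_fst pp).
  have p3 := poly_time_snd pp.
  apply: poly_time_if => //; first by poly_time_auto.
  by apply: poly_time_if => //; poly_time_auto.
- exact: poly_time_const.
- by poly_time_auto.
- move=> w [ds F] [b|b|]; rewrite /= !tree_size_pair ?tree_size_cons.
  + by have := tree_size_bool b; lia.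
  + rewrite tree_size_nil; have := tree_size_bool b; case: F => [|C F] /=;
      rewrite ?tree_size_cons ?tree_size_nil !tree_size_pair; lia.
  + by rewrite tree_size_nil; lia.
Qed.

Lemma poly_time_unparse : poly_time unparse.
Proof.
have digits (G : codeType) (s : G -> seq bool) : poly_time s -> poly_time (fun x => map Digit (s x)).
  move=> ps; apply: (poly_time_map (h := fun _ b => Digit b)) => //.
  by apply: poly_time_of_bool; poly_time_auto.
rewrite /unparse; apply: poly_time_cat; first by apply: digits; poly_time_auto.
apply: poly_time_flatten; apply: poly_time_map; last by poly_time_auto.
apply: poly_time_cat; last exact: poly_time_const.
apply: poly_time_flatten; apply: poly_time_map; last by poly_time_auto.
apply: poly_time_cons; last by apply: digits; poly_time_auto.
by apply: poly_time_of_bool; poly_time_auto.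
Qed.

Lemma poly_time_canonical (G : codeType) (s : G -> seq bool) :
  poly_time s -> poly_time (fun x => canonical (s x)).
Proof.
apply: poly_time_comp; apply: poly_time_orb.
  by apply: poly_time_eq; [apply: poly_time_id | apply: poly_time_const].
exact/poly_time_head/poly_time_rev/poly_time_id.
Qed.

Lemma poly_time_less (G : codeType) (s t : G -> seq bool) :
  poly_time s -> poly_time t -> poly_time (fun x => less (s x) (t x)).
Proof.
move=> ps pt; apply: (poly_time_app2 (h := less)) => //; rewrite /less.
have pf : poly_time (fun y : seq bool * seq bool =>
    foldl (fun (st : seq bool * bool) d =>
      (behead st.1, if head false st.1 == d then st.2 else d)) (y.1, false) y.2).
  have D_poly : poly_bounded (fun p : seq bool * seq bool * bool => 3).
    exact: poly_bounded_const.
  apply: (poly_time_foldl_additive (G := (seq bool * seq bool)%type)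
    (h := fun _ (st : seq bool * bool) d =>
      (behead st.1, if head false st.1 == d then st.2 else d)) _ _ _ D_poly);
    try by poly_time_auto.
  move=> y [u b] d; rewrite !tree_size_pair /= -drop1.
  apply: (@leq_trans (tree_size u + 3).+1).
    by rewrite ltnS leq_add ?tree_size_drop ?tree_size_bool.
  by rewrite addSn ltnS leq_add2r leq_addr.
apply: poly_time_andb; last exact: poly_time_snd pf.
by apply: poly_time_eq; [exact: poly_time_fst pf | exact: poly_time_const].
Qed.

Lemma poly_time_accept k c : poly_time (accept k c).
Proof.
have pp := poly_time_parse.
have p1 := poly_time_fst pp; have p2 := poly_time_snd pp.
rewrite /accept; apply: poly_time_andb.
  apply: poly_time_eq; last exact: poly_time_id.
  exact: poly_time_comp poly_time_unparse pp.
apply: poly_time_andb.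
  rewrite /valid_names; apply: poly_time_andb; first exact: poly_time_canonical.
  apply: poly_time_all => //; apply: poly_time_all; last by poly_time_auto.
  apply: poly_time_andb; first by apply: poly_time_canonical; poly_time_auto.
  apply: poly_time_less; first by poly_time_auto.
  by apply: (poly_time_comp (g := fun w => (parse w).1)) => //; poly_time_auto.
apply: poly_time_andb.
  rewrite /width_int; case: k => m; last exact: poly_time_nilp.
  by rewrite /width_le; apply: (poly_time_all (p := fun _ C => size C <= m)) => //; poly_time_auto.
apply: (poly_time_comp (g := majority_test c)).
  exact: poly_time_majority_test.
apply: poly_time_filter => //.
by apply/poly_time_negb/poly_time_tautology; poly_time_auto.
Qed.

End Acceptance.

(** * Turing machines *)

Lemma runs_pour_IA (Sigma : finType) (w m a b c : seq (Sigma + bool)) :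
  runs (pour Sigma rI rA) (Store w m a b c) (4 * size w).+1 (Store [::] m (catrev w a) b c).
Proof.
elim: w a => [|x w IH] a; first exact: runs_While0.
eapply runs_leq; last first.
  eapply runs_While; [by [] | | exact: IH].
  by eapply runs_Seq; [apply: runs_Push | apply: runs_Pop].
by rewrite /= mulnS.
Qed.

Notation Y := (cnf_symbol + bool)%type.

Definition put_symbol (l : seq cnf_symbol) : cmd Y :=
  foldr (fun (s : cnf_symbol) c =>
    If rA (fun o => o == Some (inl s)) (put_bits _ (polish (symbol_to_tree s))) c) Skip l.

Lemma runs_put_symbol (s : cnf_symbol) l w m a b c : s \in l ->
  runs (put_symbol l) (Store w m (inl s :: a) b c) (size l + 2 * tree_size s + 1)
    (Store w (code _ s ++ m) (inl s :: a) b c).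
Proof.
elim: l => //= u l IH; rewrite inE => sul; rewrite !addSn; apply: runs_If => /=.
case: (s =P u) sul => [<- _|su] /=.
  rewrite eqxx; apply: runs_leq (runs_put_bits _ _ _ _ _ _).
  by rewrite -addnA addn1 leq_addl.
rewrite (_ : _ == _ = false); first exact: IH.
by apply/eqP => -[].
Qed.

Definition symbols : seq cnf_symbol :=
  [:: Digit true; Digit false; Sign true; Sign false; EndClause].

(** Pouring reverses the input, so the list is built from its end: the initial [false] is the empty
    list, and each [true] put above the code of a symbol is a list node. *)
Definition load : cmd Y :=
  Seq (pour _ rI rA) (Seq (put_bits _ [:: false])
    (While rA isSome (Seq (put_symbol symbols) (Seq (put _ true rM) (Pop rA))))).

Lemma tree_size_symbol (s : cnf_symbol) : tree_size s <= 11.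
Proof. by case: s => [[]|[]|]. Qed.

Lemma runs_load (w : seq cnf_symbol) :
  runs load (Store (map inl w) [::] [::] [::] [::]) (40 * size w + 5)
    (main_store [::] (code _ w)).
Proof.
set loop := While rA isSome (Seq (put_symbol symbols) (Seq (put _ true rM) (Pop rA))).
have runs_loop u v : runs loop (Store [::] (code _ v) (map inl u) [::] [::]) (32 * size u + 1)
    (main_store [::] (code _ (catrev u v))).
  elim: u v => [|s u IH] v; first exact: runs_While0.
  eapply runs_leq; last first.
    eapply runs_While; [by [] | | exact: IH].
    eapply runs_Seq; first by apply: (@runs_put_symbol s); case: (s) => [[]|[]|].
    eapply runs_Seq; first exact: runs_Push.
    rewrite -[code _ (s :: v)]cats0 code_cons cats0; exact: runs_Pop.
  by have := tree_size_symbol s; rewrite /= mulnS; lia.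
eapply runs_leq; last first.
  eapply runs_Seq; first exact: runs_pour_IA.
  eapply runs_Seq; first exact: runs_put_bits.
  have := runs_loop (rev w) [::]; rewrite catrevE revK cats0 map_rev -[rev _]cats0 -catrevE; exact.
by rewrite size_map size_rev /=; lia.
Qed.

Lemma tree_size_symbols (w : seq cnf_symbol) : tree_size w <= 12 * size w + 1.
Proof.
rewrite mulnC addn1; apply: tree_size_seq_le => s _; exact: tree_size_symbol.
Qed.

Lemma affine_power_le a b c : exists d, forall n, (a * n + b) ^ c <= n ^ d + d.
Proof.
(* The first summand covers [n < 2]. For [n >= 2], [m <= n ^ m] and [n.+1 <= n ^ 2] give
   [m * n.+1 <= n ^ m.+2]. *)
pose m := a + b + 2; exists ((2 * m) ^ c + m.+2 * c) => n.
have le_m : a * n + b <= m * n.+1 by rewrite /m; nia.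
have [n2|n2] := leqP 2 n; last first.
  apply: leq_trans (_ : (2 * m) ^ c <= _); last by rewrite addnCA leq_addr.
  case: c => // c; rewrite leq_exp2r //; apply: leq_trans le_m _.
  by rewrite mulnC leq_mul2r; lia.
apply: leq_trans (_ : n ^ (m.+2 * c) <= _).
  rewrite expnM; case: c => // c; rewrite leq_exp2r // (leq_trans le_m) // -addn2 expnD.
  apply: leq_mul; last by rewrite -mulnn; nia.
  by rewrite (leq_trans (ltnW (ltn_expl m (ltnSn 1)))) // leq_exp2r // /m addn2.
by rewrite (leq_trans _ (leq_addr _ _)) // leq_exp2l ?leq_addl // ltnW.
Qed.

Lemma poly_time_in_P (f : seq cnf_symbol -> bool) : poly_time cnf_symbol f -> in_P f.
Proof.
(* Coded inputs have size at most 12 per symbol plus 1, so [(40 * size w + 46) ^ c] bounds [T w].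
   The extra factor in the exponent [c.+1] pays for loading and for the verdict step. *)
move=> [p [T [[c Tc] pf]]]; have [d Hd] := affine_power_le 40 46 c.+1.
exists (machine (Seq load p)), d => w; exists (f w) => //.
have [t tT E] : runs (Seq load p) (Store (map inl w) [::] [::] [::] [::])
    (40 * size w + 5 + T w) (main_store [::] (code _ (f w))).
  eapply runs_Seq; first exact: runs_load.
  by have := pf w [::] [::]; rewrite !cats0.
have -> : f w = (ohead (st_main (main_store [::] (code cnf_symbol (f w)))) == Some (inr true)).
  by case: (f w).
apply: machine_answers E _; apply: leq_ltn_trans tT _; apply: leq_trans (Hd _).
have {}Tc : T w <= (40 * size w + 46) ^ c.
  apply: leq_trans (Tc w) _; case: (c) => // c'; rewrite leq_exp2r //.
  apply: (@leq_trans (12 * size w + 1).+2); last by lia.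
  by rewrite !ltnS tree_size_symbols.
have X0 : 0 < (40 * size w + 46) ^ c by rewrite expn_gt0 addnS.
by rewrite expnS; move: (size w) (_ ^ c) Tc X0 => n X Tc X0; nia.
Qed.

Theorem theorem1p4 (k : int) (hk : (k <= 3)%R) : in_P (GtMajoritySAT k).
Proof.
have [c cP] := acceptP.
have [M [d Md]] := poly_time_in_P (poly_time_accept cnf_symbol k c).
exists M, d => w; have [b bM bf] := Md w; exists b => //.
by rewrite bf; apply: cP.
Qed.
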